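(* For every $k\ge3$, $$\frac1{2\pi}\int_0^{2\pi}D_{2k}(\varphi)\,d\varphi=D_{2k}^{\mathrm{Wick}}+\mathrm{VO}_{2k},$$ where $$\mathrm{VO}_{2k}=\sum_{\substack{(P,S):\\ |\mathcal{M}_k(P,S)|\ge2}}\frac2P\sum_{\substack{\{M,M'\}\subset\mathcal{M}_k(P,S)\\ M\ne M'}}\mathrm{mult}(M)\,\mathrm{mult}(M')\,R(M)\,R(M')$$ runs over pairs $(P,S)$ for which the set $\mathcal{M}_k(P,S)$ of $k$-element multisets from $\mathbb{N}=\{1,2,\dots\}$ with product $P$ and sum $S$ has at least two elements; here $\mathrm{mult}(M)=k!/\prod_v m_v!$ counts orderings of $M$ and $R(M)=\prod_v r_v^{m_v}$, with $m_v$ the multiplicity of $v$ in $M$. In general $\mathrm{VO}_{2k}\ne0$; the minimal witness at $k=3$ is $\{1,6,6\}\leftrightarrow\{2,2,9\}$ (both have sum $13$ and product $36$, but they are distinct multisets).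
   Context: $\nu$ is the middle-thirds Cantor measure rescaled to $[\theta_0,\theta_1]\subset(0,2\pi)$ with centre $\varphi=(\theta_0+\theta_1)/2$, and $\hat\nu(n)=\int e^{in\theta}d\nu=e^{in\varphi}r_n$, where $r_n=\prod_{j\ge1}\cos\bigl(\tfrac{(\theta_1-\theta_0)n}{2\cdot3^j}\bigr)\in\mathbb{R}$ depends only on the width. Define $$D_{2k}(\varphi)=\sum_{n_1\cdots n_k=m_1\cdots m_k}\frac{\hat\nu(n_1)\cdots\hat\nu(n_k)\overline{\hat\nu(m_1)\cdots\hat\nu(m_k)}}{n_1\cdots n_k},$$ the sum over positive integers, regarded as a real trigonometric polynomial (series) in $\varphi$: grouping by $\delta=\sum n_i-\sum m_i$, $D_{2k}(\varphi)=W^{(k)}_0+2\sum_{\delta>0}W^{(k)}_\delta\cos(\delta\varphi)$ with $W_\delta^{(k)}\in\mathbb{R}$. $D_{2k}^{\mathrm{Wick}}$ denotes the diagonal part of the sum, i.e. the contribution of terms with $\{n_1,\dots,n_k\}=\{m_1,\dots,m_k\}$ as multisets.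
   Formalization: The factor of r_n is taken as cos((θ1−θ0)n/3^j) instead of the printed cos((θ1−θ0)n/(2·3^j)), because the printed product is the Fourier transform of the Cantor measure of half the width and contradicts ν̂(n)=e^{inφ}r_n. *)

(* Defs.v *)
From HB Require Import structures.
From mathcomp Require Import all_boot all_order all_algebra finmap multiset.
From mathcomp Require Import complex.
From mathcomp Require Import all_classical all_reals all_analysis.
From mathcomp Require Import measurable_realfun.

Set Implicit Arguments.
Unset Strict Implicit.
Unset Printing Implicit Defensive.

Import Order.TTheory GRing.Theory Num.Theory.
Import numFieldNormedType.Exports.

Local Open Scope mset_scope.
Local Open Scope classical_set_scope.
Local Open Scope ring_scope.
Local Open Scope complex_scope.

Section complex_sums_and_integrals.
Context {R : realType}.

(* The sum of an absolutely summable real family over an arbitrary index set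
   (meaningful only when [summable A (EFin \o f)] holds). *)
Definition rsum (I : choiceType) (A : set I) (f : I -> R) : R :=
  fine (\esum_(i in A) ((EFin \o f)^\+ i)%E) -
  fine (\esum_(i in A) ((EFin \o f)^\- i)%E).

Definition csummable (I : choiceType) (A : set I) (f : I -> R[i]) : Prop :=
  summable A (fun i => (complex.Re (f i))%:E) /\
  summable A (fun i => (complex.Im (f i))%:E).

Definition csum (I : choiceType) (A : set I) (f : I -> R[i]) : R[i] :=
  rsum A (fun i => complex.Re (f i)) +i* rsum A (fun i => complex.Im (f i)).

Context d (T : measurableType d) (mu : {measure set T -> \bar R}).

Definition cintegrable (A : set T) (f : T -> R[i]) : Prop :=
  mu.-integrable A (fun x => (complex.Re (f x))%:E) /\
  mu.-integrable A (fun x => (complex.Im (f x))%:E).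

Definition cintegral (A : set T) (f : T -> R[i]) : R[i] :=
  (\int[mu]_(x in A) complex.Re (f x)) +i*
  (\int[mu]_(x in A) complex.Im (f x)).

End complex_sums_and_integrals.

Section cantor_measure.
Context {R : realType}.
Implicit Types (x : R) (j : nat).

Definition bin_digit j x : R :=
  (Num.floor (2 ^+ j.+1 * x))%:~R - 2 * (Num.floor (2 ^+ j * x))%:~R.

(* On [0, 1] this replaces each binary digit b of x by the ternary digit 2b:
   a right inverse of the Cantor function, so it pushes the uniform
   probability on [0, 1] to the middle-thirds Cantor measure. *)
Definition cantor_map x : R :=
  limn (series (fun j => 2 * bin_digit j x / 3 ^+ j.+1)).

Lemma bin_digit_ge0 j x : 0 <= bin_digit j x.
Proof.
rewrite /bin_digit exprS -mulrA; set y := 2 ^+ j * x.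
have -> : 2 * (Num.floor y)%:~R = (2 * Num.floor y)%:~R :> R by rewrite intrM.
rewrite subr_ge0 ler_int floor_ge_int intrM.
by rewrite ler_pM2l// floor_le.
Qed.

Lemma bin_digit_le1 j x : bin_digit j x <= 1.
Proof.
rewrite /bin_digit exprS -mulrA; set y := 2 ^+ j * x.
have -> : 2 * (Num.floor y)%:~R = (2 * Num.floor y)%:~R :> R by rewrite intrM.
rewrite lerBlDl -[1]/(1%:~R) -intrD ler_int -ltzD1 floor_lt_int.
have /andP[_ hy] := floor_itv y.
rewrite !intrD intrM -addrA.
have -> : (1%:~R + 1%:~R : R) = 2 * 1%:~R by rewrite mulr1.
by rewrite -mulrDr ltr_pM2l// -intrD.
Qed.

Lemma cantor_map_cvg x :
  series (fun j => 2 * bin_digit j x / 3 ^+ j.+1) @ \oo --> cantor_map x.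
Proof.
apply: (@series_le_cvg _ _ (geometric (2 / 3) (3^-1))).
- by move=> n; rewrite divr_ge0 ?mulr_ge0 ?bin_digit_ge0 ?exprn_ge0.
- by move=> n /=; rewrite mulr_ge0 ?exprn_ge0.
- move=> n /=; rewrite exprS invfM mulrA exprVn ler_pM2r ?invr_gt0 ?exprn_gt0//.
  by rewrite ler_pM2r ?invr_gt0// ger_pMr// bin_digit_le1.
- by apply: is_cvg_geometric_series; rewrite ger0_norm// invf_lt1// ltr1n.
Qed.

Lemma measurable_bin_digit j : measurable_fun setT (bin_digit j).
Proof.
have mfl i : measurable_fun setT
    (fun x : R => ((Num.floor (2 ^+ i * x))%:~R : R)).
  apply: nondecreasing_measurable => // x y xy.
  by rewrite ler_int le_floor// ler_pM2l// exprn_gt0.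
by apply: measurable_funB => //; apply: measurable_funM.
Qed.

Lemma measurable_cantor_map : measurable_fun setT cantor_map.
Proof.
apply: (@measurable_fun_cvg _ _ _ _
  (fun n x => series (fun j => 2 * bin_digit j x / 3 ^+ j.+1) n)).
- move=> n; apply: measurable_sum => j.
  apply: measurable_funM => //; apply: measurable_funM => //.
  exact: measurable_bin_digit.
- by move=> x _; exact: cantor_map_cvg.
Qed.

(* [uniform_prob] lives on [measurableTypeR R], which is not syntactically the
   measurable type carried by [R] itself. *)
Definition cantor_rv : measurableTypeR R -> R := cantor_map.

HB.instance Definition _ :=
  isMeasurableFun.Build _ _ _ _ cantor_rv measurable_cantor_map.

Definition affine_on (a b x : R) : R := a + (b - a) * x.

Lemma measurable_affine_on a b : measurable_fun setT (affine_on a b).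
Proof. by apply: measurable_funD => //; apply: measurable_funM. Qed.

HB.instance Definition _ a b :=
  isMeasurableFun.Build _ _ _ _ (affine_on a b) (measurable_affine_on a b).

Definition cantor_measure : probability R R :=
  distribution (uniform_prob (@ltr01 R)) cantor_rv.

Definition cantor_measure_on (a b : R) : probability R R :=
  distribution cantor_measure (affine_on a b).

End cantor_measure.

Definition D_index (k : nat) : set (k.-tuple nat * k.-tuple nat) :=
  [set nm : k.-tuple nat * k.-tuple nat | [/\ all (leq 1) nm.1,
    all (leq 1) nm.2 &
    (\prod_(n <- nm.1) n = \prod_(m <- nm.2) m)%N]].
Arguments D_index : clear implicits.

Section fourier_coefficients.
Context {R : realType}.
Implicit Types (w phi t : R) (n : nat).

Definition expi t : R[i] := cos t +i* sin t.

(* Fourier coefficient of the Cantor measure of centre phi and width w. *)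
Definition nuhat w phi n : R[i] :=
  cintegral (cantor_measure_on (phi - w / 2) (phi + w / 2)) setT
    (fun theta => expi (n%:R * theta)).

(* The Cantor measure on [- w / 2, w / 2] is the law of the sum over j >= 1 of
   e_j * w / 3 ^ j with independent fair signs e_j, and
   w / 2 = \sum_(j >= 1) w / 3 ^ j.  So the factor of index j is
   cos (w n / 3 ^ j); with cos (w n / (2 * 3 ^ j)) the product would be the
   Fourier transform of the Cantor measure of width w / 2. *)
Definition rhat w n : R :=
  limn (fun J => \prod_(1 <= j < J.+1) cos (w * n%:R / 3 ^+ j)).

End fourier_coefficients.

Definition D_term (R : realType) (w : R) (k : nat) (phi : R)
    (nm : k.-tuple nat * k.-tuple nat) : R[i] :=
  (\prod_(n <- nm.1) nuhat w phi n) *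
  conjc (\prod_(m <- nm.2) nuhat w phi m) / (\prod_(n <- nm.1) n)%N%:R.
Arguments D_term {R} w k phi nm.

Section moments.
Context {R : realType}.
Implicit Types (w phi : R) (k P S : nat) (M : {mset nat}).

Definition D2k w k phi : R[i] := csum (D_index k) (D_term w k phi).

Definition D2k_Wick w k phi : R[i] :=
  csum (D_index k `&`
    [set nm : k.-tuple nat * k.-tuple nat | seq_mset nm.1 = seq_mset nm.2])
    (D_term w k phi).

Definition Mset k P S : set {mset nat} :=
  [set M | [/\ size M = k, (forall v, v \in M -> (0 < v)%N),
    (\prod_(v <- M) v = P)%N & (\sum_(v <- M) v = S)%N]].

(* The elements of a multiset of [Mset k P S] divide P, so that [Mset k P S]
   is finite and [fset_set] loses nothing. *)
Definition Mfset k P S : {fset {mset nat}} := fset_set (Mset k P S).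

Definition mult M : nat := ((size M)`! %/ \prod_(v <- finsupp M) (M v)`!)%N.

Definition Rprod w M : R := \prod_(v <- finsupp M) rhat w v ^+ M v.

Definition VO_index k : set (nat * nat) :=
  [set PS | (2 <= #|` Mfset k PS.1 PS.2|)%N].

(* The inner sum runs over the unordered pairs {M, M'} with M != M', that is
   over the two-element subsets of the finite set of multisets. *)
Definition VO_term w k (PS : nat * nat) : R :=
  2 / PS.1%:R *
  \sum_(A <- fpowerset (Mfset k PS.1 PS.2) | #|` A| == 2%N)
    \prod_(M <- A) ((mult M)%:R * Rprod w M).

Definition VO2k w k : R := rsum (VO_index k) (VO_term w k).

End moments.

(* Main.v *)
Require Import Defs.
From HB Require Import structures.
From mathcomp Require Import all_boot all_order all_algebra finmap multiset.
From mathcomp Require Import complex.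
From mathcomp Require Import all_classical all_reals all_analysis.
From mathcomp Require Import measurable_realfun.
From mathcomp Require Import zify ring lra.

(** The Fourier coefficients of the Cantor measure of centre phi and width w are
    e^(i n phi) r_n with r_n real ([nuhatE]): adding one ternary digit multiplies
    the Fourier transform by one cosine ([sum_cos_ternary]).  Hence the term of
    index (n, m) is e^(i delta phi) times a real number [coef] that does not
    depend on phi, with delta = sum n - sum m ([D_termE]).  Averaging over phi
    keeps the terms with delta = 0 ([average_rsum]).  Among them, those with equal
    multisets form the Wick part.  The others are grouped, first by the ordered
    pair (M, M') of multisets, which comes from mult M * mult M' pairs of tuples,
    then by the common product P and sum S ([rsum_offdiag]); every unordered pair
    {M, M'} appears twice.

    All these manipulations rest on absolute summability.  The r_n do not tend to
    0 in general, but they are small in mean square: over a block of length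
    B 27 ^ K, with B of order 1 / w, the sum of r_n ^ 2 is at most
    B (53 / 2) ^ K, because at each scale one of the 27 sub-blocks makes a factor
    cos ^ 2 at most 1 / 2 ([sum_prod_sqr_cos_le]).  So the sum of
    r_n ^ 2 n ^ (e - 1) converges for small e > 0 ([weighted_sum_le]).  The
    inequality 2 x y <= x ^ 2 + y ^ 2 and the divisor bound reduce the absolute sum
    to the k-th power of such a series, and give the bound C / sqrt w with C
    independent of w ([esum_coef_le]).

    That the off-diagonal part does not vanish identically follows from positivity
    on average.  As a function of w, [coef] is, up to a positive factor, a limit
    of products of cosines cos (a w), so its integral over ]0, T] against the
    positive definite function 1 - w / T is nonnegative ([posdef_prods]).  For the
    pair of tuples (1, 6, 6, 1, ..., 1), (2, 2, 9, 1, ..., 1) and T small it is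
    positive, since then all r_n involved are at least 1 / 2.  The bound C / sqrt w
    is integrable at 0, so the off-diagonal sum may be integrated term by term and
    has a positive integral ([exists_VO2k_neq0]).

    The minimality for k = 3 is a finite search: a product below 36 or a sum below
    13 bounds all entries ([VO_index3_ge]). *)

Set Implicit Arguments.
Unset Strict Implicit.
Unset Printing Implicit Defensive.

Import Order.TTheory GRing.Theory Num.Theory.
Import numFieldNormedType.Exports.

Local Open Scope mset_scope.
Local Open Scope classical_set_scope.
Local Open Scope ring_scope.
Local Open Scope complex_scope.

(** * Divisors and orderings *)

Section counting.
Local Open Scope nat_scope.

Lemma size_divisors n :
  size (divisors n) = \prod_(p <- primes n) (logn p n).+1.
Proof.
have -> : \prod_(p <- primes n) (logn p n).+1 =
    \prod_(f <- prime_decomp n) f.2.+1 by rewrite prime_decompE big_map.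
rewrite /divisors; elim: (prime_decomp n) => [|[p e] s IHs] /=.
  by rewrite big_nil.
rewrite big_cons /= -IHs; set ds := foldr _ _ _.
elim: e => [|e IHe] /=; first by rewrite mul1n.
by rewrite size_merge size_cat size_map IHe mulSn addnC.
Qed.

Lemma leq_exp2rW m n e : m <= n -> m ^ e <= n ^ e.
Proof. by case: e => // e; rewrite leq_exp2r. Qed.

(** (a + 1) ^ E is at most the product (a + 1) ... (a + E), which is E! times a
    binomial coefficient. *)
Lemma expnS_le_fact a E : a.+1 ^ E <= E`! * 2 ^ E * 2 ^ a.
Proof.
rewrite -mulnA -expnD (addnC E).
have hff : a.+1 ^ E <= (a + E) ^_ E.
  rewrite ffact_prod -[in leqLHS](card_ord E) -prod_nat_const.
  by apply: leq_prod => i _; have := ltn_ord i; lia.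
apply: leq_trans hff _; rewrite -bin_ffact mulnC leq_mul2l.
apply/orP; right; rewrite -[in leqRHS](addn1 1) expnDn.
rewrite (bigD1 (inord E : 'I_(a + E).+1)) //= inordK; last by lia.
by rewrite !exp1n !muln1 leq_addr.
Qed.

(** The divisor bound d(n) << n^(1/E), with the E-th root cleared so that it is a
    statement about integers.  In d(n) ^ E = \prod_p (a_p + 1) ^ E a prime
    p >= 2 ^ E contributes at most p ^ a_p, because a + 1 <= 2 ^ a; each of the
    at most 2 ^ E smaller primes costs one extra constant. *)
Lemma size_divisors_le E n : 0 < n ->
  size (divisors n) ^ E <= (E`! * 2 ^ E) ^ (2 ^ E) * n.
Proof.
move=> n_gt0; set C := E`! * 2 ^ E.
have C_gt0 : 0 < C by rewrite muln_gt0 fact_gt0 expn_gt0.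
rewrite size_divisors [X in _ <= _ * X](prod_prime_decomp n_gt0) prime_decompE big_map.
rewrite (big_morph _ (fun x y => expnMn x y E) (exp1n E)) /=.
(* the price paid for the prime p *)
pose c p := if p < 2 ^ E then C else 1.
apply: (@leq_trans (\prod_(p <- primes n) (c p * p ^ logn p n))).
  rewrite !big_seq; apply: leq_prod => p; rewrite mem_primes => /and3P[p_prime _ _].
  rewrite /c; case: ltnP => hp.
    apply: leq_trans (expnS_le_fact _ _) _.
    by rewrite leq_mul2l leq_exp2rW ?orbT// prime_gt1.
  rewrite mul1n; apply: (@leq_trans ((2 ^ logn p n) ^ E)).
    by rewrite leq_exp2rW // ltn_expl.
  by rewrite -expnM mulnC expnM leq_exp2rW.
rewrite big_split leq_mul2r; apply/orP; right.
rewrite /c -big_mkcond /= big_const_seq iter_muln_1.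
rewrite leq_pexp2l // -size_filter -[leqRHS](size_iota 0).
apply: uniq_leq_size; first by rewrite filter_uniq ?primes_uniq.
by move=> p; rewrite mem_filter mem_iota => /andP[].
Qed.

(** The multinomial formula, by induction on the first entry of the ordering.
    The product runs over an arbitrary duplicate-free u containing s, so that u
    can stay the same when an entry is removed from s. *)
Lemma size_permutations_prod_fact (T : eqType) (s u : seq T) :
  uniq u -> {subset s <= u} ->
  size (permutations s) * \prod_(v <- u) (count_mem v s)`! = (size s)`!.
Proof.
move=> u_uniq; have [n] := ubnP (size s); elim: n s => // n IHn s /ltnSE-s_le su.
case: (eqVneq s [::]) => [->|s_neq0].
  by rewrite big1.
rewrite (perm_size (permutationsE _)) ?lt0n ?size_eq0 // size_allpairs_dep.
rewrite sumnE big_map big_distrl /=.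
rewrite (eq_big_seq (fun x => count_mem x s * (size s).-1`!)); last first.
  move=> x; rewrite mem_undup => xs.
  have -> : (size s).-1 = size (rem x s) by rewrite size_rem.
  rewrite -(IHn (rem x s)); last 2 first.
  - by rewrite size_rem // prednK // lt0n size_eq0.
  - by move=> v /mem_rem /su.
  have xu := su x xs; rewrite mulnCA; congr (_ * _).
  rewrite !(bigD1_seq x xu u_uniq) /= mulnA.
  have cE v : count_mem v (rem x s) = count_mem v s - (x == v).
    by rewrite count_rem xs.
  rewrite cE eqxx subn1; congr (_ * _).
    have : 0 < count_mem x s by rewrite -has_count has_pred1.
    by case: (count_mem x s) => // c _; rewrite factS mulnC.
  by apply: eq_bigr => v /negbTE vx; rewrite cE eq_sym vx subn0.
rewrite -big_distrl /=.
have -> : \sum_(x <- undup s) count_mem x s = size s.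
  rewrite -[RHS](perm_size (perm_count_undup s)) size_flatten /shape -map_comp.
  by rewrite sumnE big_map; apply: eq_bigr => x _; rewrite /= size_nseq.
have : 0 < size s by rewrite lt0n size_eq0.
by case: (size s) => // c _; rewrite factS.
Qed.
End counting.

(** * The cosine product *)

Section riesz_products.
Context {R : realType}.
Implicit Types (x w : R) (n K J : nat).

Lemma norm_sin_le x : `|sin x| <= `|x|.
Proof.
wlog x_gt0 : x / 0 < x => [hwlog|].
  have [x_lt0|/hwlog//|->] := ltrgtP x 0; last by rewrite sin0 normr0.
  by rewrite -normrN -sinN -[leRHS]normrN hwlog// oppr_gt0.
have [c _] : exists2 c, c \in `]0, x[ & sin x - sin 0 = cos c * (x - 0).
  apply: (@MVT R sin cos 0 x x_gt0).
  by apply: continuous_subspaceT => y; exact: continuous_sin.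
rewrite sin0 !subr0 => ->; rewrite normrM.
by rewrite ler_piMl// cos_max.
Qed.

Lemma cos_ge_onem x : 1 - x ^+ 2 / 2 <= cos x.
Proof.
have -> : cos x = 1 - 2 * sin (x / 2) ^+ 2.
  rewrite [x in LHS](_ : x = (x / 2) *+ 2); last by field.
  by rewrite cos_mulr2n cos2sin2; ring.
have : sin (x / 2) ^+ 2 <= (x / 2) ^+ 2.
  rewrite -[leLHS]real_normK ?num_real// -[leRHS]real_normK ?num_real//.
  by rewrite lerXn2r ?nnegrE// norm_sin_le.
rewrite expr_div_n; lra.
Qed.

(** The partial products of [rhat w n], as functions of x = w n alone. *)
Definition cosprod x J : R := \prod_(1 <= j < J.+1) cos (x / 3 ^+ j).

Lemma cosprodS x J : cosprod x J.+1 = cosprod x J * cos (x / 3 ^+ J.+1).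
Proof. by rewrite /cosprod big_nat_recr. Qed.

Lemma cosprod0 x : cosprod x 0 = 1.
Proof. by rewrite /cosprod big_geq. Qed.

Lemma norm_cosprod_le1 x J : `|cosprod x J| <= 1.
Proof.
elim: J => [|J IHJ]; first by rewrite cosprod0 normr1.
by rewrite cosprodS normrM mulr_ile1// cos_max.
Qed.

(** The factors are 1 + O(x ^ 2 / 9 ^ j), so that the partial products form a
    telescoping series dominated by a geometric one. *)
Lemma is_cvg_cosprod x : cvgn (cosprod x).
Proof.
have hs : cvgn (series (telescope (cosprod x))).
  apply: normed_cvg.
  apply: (@series_le_cvg _ _ (geometric (x ^+ 2) (3^-1))) => [n|n|n|] /=.
  - exact: normr_ge0.
  - by rewrite mulr_ge0 ?sqr_ge0 ?exprn_ge0.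
  - rewrite /telescope /= cosprodS -[X in _ - X]mulr1 -mulrBr normrM.
    apply: (@le_trans _ _ `|cos (x / 3 ^+ n.+1) - 1|).
      by rewrite ler_piMl ?norm_cosprod_le1.
    rewrite ler0_norm ?subr_le0 ?cos_le1// opprB.
    have := cos_ge_onem (x / 3 ^+ n.+1).
    rewrite expr_div_n -exprM => h.
    suff : x ^+ 2 / 3 ^+ (n.+1 * 2) <= x ^+ 2 / 3 ^+ n.
      rewrite exprVn; set a := _ / 3 ^+ n; set b := _ / 3 ^+ (n.+1 * 2) in h * => ab.
      have : 0 <= b by rewrite divr_ge0 ?sqr_ge0 ?exprn_ge0.
      by move: h; lra.
    rewrite ler_wpM2l ?sqr_ge0// lef_pV2 ?posrE ?exprn_gt0//.
    by rewrite ler_weXn2l ?ler1n//; lia.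
  - by apply: is_cvg_geometric_series; rewrite ger0_norm// invf_lt1// ltr1n.
rewrite (_ : cosprod x = cst (cosprod x 0) \+ series (telescope (cosprod x))).
  by apply: is_cvgD => //; exact: is_cvg_cst.
by apply/funext => n /=; rewrite -eq_sum_telescope.
Qed.

Lemma rhatE w n : rhat w n = limn (cosprod (w * n%:R)).
Proof. by []. Qed.

Lemma cvg_rhat w n : cosprod (w * n%:R) @ \oo --> rhat w n.
Proof. by rewrite rhatE; exact: is_cvg_cosprod. Qed.

Lemma norm_rhat_le1 w n : `|rhat w n| <= 1.
Proof.
have h : (fun J => `|cosprod (w * n%:R) J| : R) @ \oo --> (`|rhat w n| : R).
  by apply: cvg_norm; exact: cvg_rhat.
apply: (cvgr_to_le h) => //.
by apply: nearW => J; exact: norm_cosprod_le1.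
Qed.

(** Every factor is at most 1 in absolute value, so factors may be dropped:
    only those whose index is a multiple of 3 are kept.  The resulting scale 27
    is what [exists_good_subinterval] needs. *)
Lemma sqr_cosprod_le x K d :
  cosprod x (3 * K + d) ^+ 2 <= \prod_(1 <= i < K.+1) cos (x / 27 ^+ i) ^+ 2.
Proof.
have cos2_le1 y : cos y ^+ 2 <= 1 by rewrite cos2sin2 lerBlDr lerDl sqr_ge0.
have hS J : cosprod x J.+1 ^+ 2 <= cosprod x J ^+ 2.
  by rewrite cosprodS exprMn ler_piMr ?sqr_ge0.
elim: d => [|d IHd]; last by rewrite addnS (le_trans _ IHd).
rewrite addn0; elim: K => [|K IHK].
  by rewrite muln0 cosprod0 big_geq // expr1n.
rewrite big_nat_recr //= mulnS addnC addn3 cosprodS exprMn.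
apply: ler_pM; rewrite ?sqr_ge0 //.
  by rewrite (le_trans _ IHK)// (le_trans (hS _)).
have -> : (3 * K).+3 = (3 * K.+1)%N by lia.
by rewrite exprM (_ : 3 ^+ 3 = 27 :> R)//; ring.
Qed.

Lemma sqr_rhat_le w n K :
  rhat w n ^+ 2 <= \prod_(1 <= i < K.+1) cos (w * n%:R / 27 ^+ i) ^+ 2.
Proof.
have h : (fun J => cosprod (w * n%:R) J ^+ 2) @ \oo --> rhat w n ^+ 2.
  by rewrite expr2; under eq_fun do rewrite expr2; apply: cvgM; exact: cvg_rhat.
apply: (cvgr_to_le h) => //; near=> J.
have -> : J = (3 * K + (J - 3 * K))%N.
  by rewrite subnKC//; near: J; exact: nbhs_infty_ge.
exact: sqr_cosprod_le.
Unshelve. all: by end_near. Qed.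

End riesz_products.

(** * Mean square over long blocks *)

Section mean_square.
Context {R : realType}.
Implicit Types (x w : R) (n K J : nat).

Lemma cos_period k x : cos (x + 2 * pi * k%:R) = cos x.
Proof.
by rewrite mulr_natr mulr_natl (periodicn (@cosD2pi R)).
Qed.

Lemma sqr_cos_le_half k x :
  pi / 4 + k%:R * pi <= x -> x <= 3 * pi / 4 + k%:R * pi -> cos x ^+ 2 <= 2^-1.
Proof.
move=> hx1 hx2; set y := x - k%:R * pi.
have h2 : cos (x *+ 2) = - cos (2 * y - pi).
  rewrite cosB cospi sinpi.
  rewrite -(cos_period k (2 * y)) /y.
  have -> : 2 * (x - k%:R * pi) + 2 * pi * k%:R = x *+ 2 by rewrite -mulr_natl; ring.
  ring.
have h3 : 0 <= cos (2 * y - pi).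
  by apply: cos_ge0_pihalf; rewrite /y; apply/andP; split; lra.
have : cos (x *+ 2) <= 0 by rewrite h2 oppr_le0.
rewrite cos_mulr2n -mulr_natl; lra.
Qed.

(** Since 27 h is at least 2 pi, the 27 consecutive intervals of length h starting
    at x cover a whole interval [pi / 4 + k pi, 3 pi / 4 + k pi], on which
    cos ^ 2 <= 1 / 2; since h is at most half the length of that interval, one
    of the 27 lies inside it. *)
Lemma exists_good_subinterval x (h : R) : 0 <= x -> 0 < h -> h <= pi / 4 ->
    2 * pi <= 27 * h ->
  exists2 b, (b < 27)%N &
    forall y, x + b%:R * h <= y -> y <= x + b%:R * h + h -> cos y ^+ 2 <= 2^-1.
Proof.
move=> x_ge0 h_gt0 h_le h_ge; have pi0 := @pi_gt0 R.
(* the first interval of the form [pi / 4 + k pi, 3 pi / 4 + k pi] with k pi > x *)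
pose k := (Num.truncn (x / pi)).+1.
have /andP[k_le k_gt] : (k.-1%:R <= x / pi < k%:R).
  by apply: truncn_itv; rewrite divr_ge0// ltW.
pose y : R := pi / 4 + k%:R * pi.
have xy : x <= y.
  by move: k_gt; rewrite ltr_pdivrMr// /y => ?; lra.
have yx : y <= x + 5 * pi / 4.
  move: k_le; have kS : k%:R = k.-1%:R + 1 :> R by rewrite natr1.
  rewrite ler_pdivlMr// /y kS; lra.
(* the first of the intervals of length h that starts after y *)
pose b := (Num.truncn ((y - x) / h)).+1.
have /andP[b_le b_gt] : (b.-1%:R <= (y - x) / h < b%:R).
  by apply: truncn_itv; rewrite divr_ge0// ?subr_ge0// ltW.
move: b_le b_gt; rewrite ler_pdivlMr// ltr_pdivrMr// => b_le b_gt.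
have bS : b%:R = b.-1%:R + 1 :> R by rewrite natr1.
exists b.
  by rewrite -(ltr_nat R) -(ltr_pM2r h_gt0); rewrite bS; lra.
move=> z hz1 hz2; apply: (@sqr_cos_le_half k).
  by rewrite -/y; lra.
by have : z <= y + 2 * h; [rewrite bS in hz2; lra|rewrite /y; lra].
Qed.

Lemma sum_nat_blocks (F : nat -> R) a M L :
  \sum_(a <= n < a + L * M) F n =
  \sum_(0 <= b < L) \sum_(a + b * M <= n < a + b * M + M) F n.
Proof.
elim: L => [|L IHL]; first by rewrite mul0n addn0 !big_geq.
rewrite big_nat_recr //= -IHL -(@big_cat_nat _ _ _ (a + L * M)%N) ?leq_addr//.
by rewrite mulSn; congr (\sum_(_ <= _ < _) _); lia.
Qed.

(** Induction on K.  A block of length B 27 ^ (K + 1) is cut into 27 sub-blocks of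
    length B 27 ^ K.  The new factor moves its argument by w B / 27 along each of
    them, so it is at most 1 / 2 on at least one: the sum is multiplied by at
    most 26 + 1 / 2 instead of 27.  The starting point a is arbitrary because the
    sub-blocks start anywhere. *)
Lemma sum_prod_sqr_cos_le w (B : nat) : 0 < w -> 2 * pi <= w * B%:R ->
    w * B%:R <= 4 * pi ->
  forall K a, \sum_(a <= n < a + B * 27 ^ K)
    \prod_(1 <= i < K.+1) cos (w * n%:R / 27 ^+ i) ^+ 2
  <= B%:R * (53 / 2) ^+ K.
Proof.
move=> w_gt0 wB_ge wB_le; elim => [|K IHK] a.
  under eq_bigr do rewrite big_geq//.
  by rewrite expn0 muln1 sumr_const_nat addKn expr0 mulr1.
have pi0 := @pi_gt0 R; set M := (B * 27 ^ K)%N.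
have -> : (B * 27 ^ K.+1 = 27 * M)%N by rewrite /M expnS; lia.
rewrite sum_nat_blocks.
set h := w * B%:R / 27.
have [||||b b_lt hb] := @exists_good_subinterval (w * a%:R / 27 ^+ K.+1) h.
- by rewrite divr_ge0 ?mulr_ge0 ?exprn_ge0 // ltW.
- by rewrite /h; lra.
- by rewrite /h; lra.
- by rewrite /h; lra.
have hle (c : nat) : \sum_(a + c * M <= n < a + c * M + M)
     \prod_(1 <= i < K.+2) cos (w * n%:R / 27 ^+ i) ^+ 2 <=
     (if c == b then 2^-1 else 1) * (B%:R * (53 / 2) ^+ K).
  apply: le_trans (ler_wpM2l _ (IHK (a + c * M)%N)); last first.
    by case: ifP.
  rewrite mulr_sumr !big_seq; apply: ler_sum => n; rewrite mem_index_iota => /andP[n1 n2].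
  rewrite big_nat_recr//= mulrC ler_wpM2r//.
    by rewrite prodr_ge0// => i _; rewrite sqr_ge0.
  case: eqVneq => [cb|_]; last by rewrite cos2sin2 lerBlDr lerDl sqr_ge0.
  have hM : w * M%:R / 27 ^+ K.+1 = h.
    rewrite /h /M natrM natrX exprS; field; rewrite -natrX pnatr_eq0 expn_eq0 //.
  set q := 27 ^+ K.+1 in hM *; have q_ge0 : 0 <= w / q.
    by rewrite divr_ge0 ?exprn_ge0// ltW.
  have e : w * a%:R / q + b%:R * h = w / q * (a + c * M)%:R.
    by rewrite -hM cb natrD natrM; ring.
  have -> : w * n%:R / q = w / q * n%:R by ring.
  apply: hb; rewrite e ?ler_wpM2l ?ler_nat//.
  have -> : h = w / q * M%:R by rewrite -hM; ring.
  by rewrite -mulrDr -natrD ler_wpM2l// ler_nat ltnW.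
apply: (@le_trans _ _ (\sum_(0 <= c < 27) (if c == b then 2^-1 else 1) * (B%:R * (53 / 2) ^+ K))).
  by apply: ler_sum => c _; exact: hle.
rewrite -mulr_suml.
have -> : \sum_(0 <= c < 27) (if c == b then 2^-1 else 1 : R) = 53 / 2.
  rewrite big_mkord (bigD1 (Ordinal b_lt))//= eqxx.
  rewrite (eq_bigr (fun=> 1)); last by move=> i /negbTE; rewrite -val_eqE /= => ->.
  rewrite sumr_const cardC1 card_ord (_ : 27.-1 = 26)%N//; lra.
by rewrite exprS mulrCA.
Qed.

(** A power saving in the mean square.  The coefficients need not tend to 0 (for
    w = pi they are constant in absolute value along the powers of 3), so
    pointwise decay is not available and the saving has to come from the mean. *)
Lemma sum_sqr_rhat_le w (B : nat) K : 0 < w -> 2 * pi <= w * B%:R ->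
    w * B%:R <= 4 * pi ->
  \sum_(0 <= n < B * 27 ^ K) rhat w n ^+ 2 <= B%:R * (53 / 2) ^+ K.
Proof.
move=> w_gt0 h1 h2; apply: le_trans (sum_prod_sqr_cos_le w_gt0 h1 h2 K 0).
by apply: ler_sum => n _; exact: sqr_rhat_le.
Qed.

End mean_square.

(** * A weighted mean square *)

Section weighted_sum.
Context {R : realType}.
Implicit Types (x w : R) (n K J B m : nat).

Lemma ln_leB1 x : 0 < x -> ln x <= x - 1.
Proof.
move=> x0; have := expR_ge1Dx (ln x); rewrite lnK ?posrE//; lra.
Qed.

Lemma harmonic_sumS_le_ln B :
  \sum_(1 <= n < B.+2) n%:R^-1 <= 1 + ln B.+1%:R :> R.
Proof.
elim: B => [|B IHB]; first by rewrite big_nat1 invr1 ln1 addr0.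
rewrite big_nat_recr//=; apply: le_trans (lerD IHB (lexx _)) _.
rewrite -addrA lerD2l.
have hB : 0 < B.+1%:R :> R by rewrite ltr0n.
have hB' : 0 < B.+2%:R :> R by rewrite ltr0n.
have := @ln_leB1 (B.+1%:R / B.+2%:R); rewrite divr_gt0// => /(_ isT).
have -> : B.+1%:R / B.+2%:R - 1 = - B.+2%:R^-1 :> R.
  by rewrite -(natr1 B.+1); field.
rewrite ln_div ?posrE// lerBlDr => h.
by rewrite -lerBrDr (le_trans h)// addrC.
Qed.

Lemma harmonic_sum_le_ln B : (0 < B)%N ->
  \sum_(1 <= n < B) n%:R^-1 <= 1 + ln B%:R :> R.
Proof.
case: B => [//|[_|B _]]; first by rewrite big_geq// ln1 addr0.
apply: le_trans (harmonic_sumS_le_ln B) _.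
by rewrite lerD2l ler_ln ?posrE ?ltr0n// ler_nat.
Qed.

(** The threshold comes from Bernoulli's inequality: 1 + 2756 / 106 = 27. *)
Lemma powR27_le m : (2756 <= m)%N -> 27 `^ (m%:R^-1) <= 107 / 106 :> R.
Proof.
move=> hm; have m0 : (0 < m)%N by lia.
have m0' : m%:R != 0 :> R by rewrite pnatr_eq0; lia.
suff h : 27 <= (107 / 106 : R) ^+ m.
  have := @ge0_ler_powR R (m%:R^-1) _ 27 ((107 / 106) ^+ m).
  rewrite !nnegrE invr_ge0 ler0n exprn_ge0 ?divr_ge0// => /(_ isT (ler0n _ 27) isT h).
  move=> /le_trans; apply.
  by rewrite -powR_mulrn ?divr_ge0// -powRrM divff// powRr1// divr_ge0.
have bern : 1 + m%:R / 106 <= (1 + 106^-1 : R) ^+ m.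
  elim: m {hm m0 m0'} => [|m IHm]; first by rewrite mul0r addr0 expr0.
  rewrite exprS -natr1; apply: le_trans (ler_wpM2l _ IHm); last by lra.
  have : 0 <= m%:R :> R by [].
  nra.
apply: le_trans (_ : _ <= (1 + 106^-1 : R) ^+ m) _; last first.
  by rewrite (_ : 107 / 106 = 1 + 106^-1 :> R)//; lra.
apply: le_trans bern; have : 2756 <= m%:R :> R by rewrite ler_nat.
lra.
Qed.

(** On a shell the mean square gains (53 / 54) ^ i over the trivial bound, while
    the weight n ^ (1 / m) loses at most 27 ^ (1 / m) per shell.  For m >= 2756
    the product of the two ratios is at most (53 / 54) (107 / 106) = 107 / 108. *)
Lemma weighted_shell_le m w B i : (2756 <= m)%N -> 0 < w ->
    2 * pi <= w * B%:R -> w * B%:R <= 4 * pi ->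
  \sum_(B * 27 ^ i <= n < B * 27 ^ i.+1)
     rhat w n ^+ 2 * n%:R `^ (m%:R^-1) / n%:R <=
  27 * B%:R `^ (m%:R^-1) * (107 / 108) ^+ i.
Proof.
move=> hm w0 h1 h2; set e := m%:R^-1; set p : R := 27 `^ e.
have B0 : 0 < B%:R :> R.
  by rewrite -(pmulr_rgt0 _ w0) (lt_le_trans _ h1)// mulr_gt0// pi_gt0.
have B0' : (0 < B)%N by rewrite ltr0n in B0.
have e0 : 0 <= e by rewrite invr_ge0.
have pE k : (27 ^ k)%:R `^ e = p ^+ k :> R.
  by rewrite natrX -powR_mulrn// powRAC powR_mulrn ?powR_ge0.
have p0 : 0 <= p by exact: powR_ge0.
pose c : R := (B%:R `^ e * p ^+ i.+1) / (B%:R * 27 ^+ i).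
apply: (@le_trans _ _ (\sum_(B * 27 ^ i <= n < B * 27 ^ i.+1) rhat w n ^+ 2 * c)).
  rewrite !big_seq; apply: ler_sum => n; rewrite mem_index_iota => /andP[n1 n2].
  rewrite -mulrA ler_wpM2l ?sqr_ge0// /c ler_pM ?powR_ge0 ?invr_ge0//.
    rewrite -pE -powRM// ge0_ler_powR ?nnegrE ?mulr_ge0//.
    by rewrite -natrM ler_nat ltnW.
  have hB : (0 < B * 27 ^ i)%N by rewrite muln_gt0 B0' expn_gt0.
  by rewrite lef_pV2 ?posrE -?natrX -?natrM ?ltr0n ?ler_nat// (leq_trans hB).
rewrite -mulr_suml.
have hs : \sum_(B * 27 ^ i <= n < B * 27 ^ i.+1) rhat w n ^+ 2 <= B%:R * (53 / 2) ^+ i.+1.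
  apply: le_trans (sum_sqr_rhat_le i.+1 w0 h1 h2).
  rewrite [leRHS](@big_cat_nat _ _ _ (B * 27 ^ i)%N)//=.
    by rewrite lerDr sumr_ge0// => n _; exact: sqr_ge0.
  by rewrite leq_mul2l leq_pexp2l ?orbT.
have c0 : 0 <= c by rewrite /c divr_ge0 ?mulr_ge0 ?powR_ge0 ?exprn_ge0.
apply: le_trans (ler_wpM2r c0 hs) _.
have -> : B%:R * (53 / 2) ^+ i.+1 * c = B%:R `^ e * ((53 / 2 * p) * (53 / 54 * p) ^+ i).
  rewrite /c !exprS !exprMn !exprVn.
  have : 27 ^+ i = 54 ^+ i / 2 ^+ i :> R.
    by rewrite -expr_div_n; congr (_ ^+ _); field.
  move=> ->; field; rewrite !expf_neq0//=; first by rewrite gt_eqF.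
rewrite -[leRHS]mulrA [leRHS]mulrCA ler_wpM2l ?powR_ge0//.
have hp := powR27_le hm; rewrite -/e -/p in hp.
by apply: ler_pM; rewrite ?exprn_ge0 ?mulr_ge0 ?lerXn2r ?nnegrE ?mulr_ge0//; lra.
Qed.

(** Convergence of the weighted mean square, with an explicit dependence on the
    width: B is of order 1 / w.  The integers below B, on which the cosine
    products do not oscillate, contribute a harmonic sum, whose logarithm is
    absorbed in a power of B; those above B are summed by shells. *)
Lemma weighted_sum_le m w B N : (2756 <= m)%N -> 0 < w ->
    2 * pi <= w * B%:R -> w * B%:R <= 4 * pi ->
  \sum_(1 <= n < N) rhat w n ^+ 2 * n%:R `^ (m%:R^-1) / n%:R <=
  (m%:R + 2917) * (B%:R `^ (m%:R^-1)) ^+ 2.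
Proof.
move=> hm w0 h1 h2; set e := m%:R^-1.
have B0 : 0 < B%:R :> R.
  by rewrite -(pmulr_rgt0 _ w0) (lt_le_trans _ h1)// mulr_gt0// pi_gt0.
have B0' : (0 < B)%N by rewrite ltr0n in B0.
have e0 : 0 <= e by rewrite invr_ge0.
have m0' : 0 < m%:R :> R by rewrite ltr0n; lia.
pose F n : R := rhat w n ^+ 2 * n%:R `^ e / n%:R.
have F0 n : 0 <= F n by rewrite /F divr_ge0// mulr_ge0 ?sqr_ge0 ?powR_ge0.
set b := B%:R `^ e; have b1 : 1 <= b.
  have <- : 1 `^ e = 1 :> R by rewrite powR1.
  by rewrite ge0_ler_powR ?nnegrE// ler1n.
have hN : (N <= B * 27 ^ N)%N.
  by apply: leq_trans (ltnW (ltn_expl N (isT : 1 < 27)%N)) _; rewrite leq_pmull.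
apply: (@le_trans _ _ (\sum_(1 <= n < B * 27 ^ N) F n)).
  case: N hN => [|N] hN; first by rewrite big_geq// sumr_ge0.
  rewrite [leRHS](@big_cat_nat _ _ _ N.+1)//=.
  by rewrite lerDl sumr_ge0.
have hK K : \sum_(1 <= n < B * 27 ^ K) F n <= \sum_(1 <= n < B) F n +
    \sum_(0 <= i < K) 27 * b * (107 / 108) ^+ i.
  elim: K => [|K IHK]; first by rewrite expn0 muln1 [X in _ + X]big_geq// addr0.
  rewrite (@big_cat_nat _ _ _ (B * 27 ^ K)%N)//=; last 2 first.
  - by rewrite muln_gt0 B0' expn_gt0.
  - by rewrite leq_mul2l leq_pexp2l ?orbT.
  by rewrite [X in _ <= _ + X]big_nat_recr//= addrA lerD// weighted_shell_le.
apply: le_trans (hK N) _.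
have hg : \sum_(0 <= i < N) 27 * b * (107 / 108) ^+ i <= 27 * b * 108.
  rewrite -mulr_sumr ler_wpM2l ?mulr_ge0 ?(le_trans _ b1)//.
  have -> : \sum_(0 <= i < N) (107 / 108 : R) ^+ i = 108 * (1 - (107 / 108) ^+ N).
    elim: N {hN} => [|N IHN]; first by rewrite big_geq// expr0 subrr mulr0.
    by rewrite big_nat_recr//= IHN exprS; lra.
  by have : 0 <= (107 / 108 : R) ^+ N by [rewrite exprn_ge0|]; lra.
(* below B the trivial bound rhat ^ 2 <= 1 is used *)
have hs : \sum_(1 <= n < B) F n <= b * (1 + m%:R * b).
  apply: (@le_trans _ _ (\sum_(1 <= n < B) b * n%:R^-1)).
    rewrite !big_seq; apply: ler_sum => n; rewrite mem_index_iota => /andP[n1 n2].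
    rewrite /F ler_wpM2r ?invr_ge0//; apply: (@le_trans _ _ (1 * n%:R `^ e)).
      rewrite ler_wpM2r ?powR_ge0// -real_normK ?num_real//.
      by rewrite expr_le1 ?norm_rhat_le1.
    by rewrite mul1r ge0_ler_powR ?nnegrE// ler_nat ltnW.
  rewrite -mulr_sumr ler_wpM2l ?(le_trans _ b1)//.
  have hb : ln B%:R <= m%:R * b.
    have -> : ln B%:R = m%:R * ln b.
      by rewrite ln_powR mulrA divff ?mul1r// gt_eqF.
    rewrite ler_wpM2l//; have := ln_leB1 (lt_le_trans ltr01 b1); lra.
  by rewrite (le_trans (harmonic_sum_le_ln B0'))// lerD2l.
apply: le_trans (lerD hs hg) _.
have : b <= b ^+ 2 by rewrite expr2 ler_peMr// (le_trans _ b1).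
have : 0 <= m%:R :> R by [].
nra.
Qed.

End weighted_sum.

(** * Reduction of the absolute sum to one variable *)

(** The larger sequence may have repetitions, so that it can be the list of values
    of a function that is not injective. *)
Lemma ler_sum_subset (R : numDomainType) (I : eqType) (s s' : seq I) (a : I -> R) :
    uniq s -> {subset s <= s'} -> (forall i, 0 <= a i) ->
  \sum_(i <- s) a i <= \sum_(i <- s') a i.
Proof.
move=> + + a_ge0; elim: s s' => [|x s IHs] s' /=.
  by move=> _ _; rewrite big_nil sumr_ge0.
move=> /andP[xs s_uniq] ss'; have xs' : x \in s' by rewrite ss' ?mem_head.
rewrite big_cons (big_rem x xs')/= lerD2l IHs// => y ys.
apply: rem_mem; first by apply: contraNneq xs => <-.
by rewrite ss'// in_cons ys orbT.
Qed.

(** All entries of a tuple with product P divide P. *)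
Lemma card_ffun_prod_le k N P : (0 < P)%N ->
  (#|[pred g : {ffun 'I_k -> 'I_N} | (\prod_i g i)%N == P]| <= size (divisors P) ^ k)%N.
Proof.
move=> P0; pose A := [pred j : 'I_N | (j %| P)%N].
apply: (@leq_trans #|ffun_on A : {pred {ffun 'I_k -> 'I_N}}|).
  apply: subset_leq_card; apply/fintype.subsetP => g; rewrite inE => /eqP gP.
  apply/ffun_onP => i; rewrite inE -gP (bigD1 i)//=; exact: dvdn_mulr.
rewrite card_ffun_on card_ord leq_exp2rW// cardE -(size_map val).
apply: uniq_leq_size; first by rewrite (map_inj_uniq val_inj) enum_uniq.
by move=> _ /mapP[j + ->]; rewrite mem_enum inE -dvdn_divisors.
Qed.

Section coefficients.
Context {R : realType}.
Implicit Types (w : R) (n N k m B : nat).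

(** The term of index [nm] without its phase. *)
Definition coef w k (nm : k.-tuple nat * k.-tuple nat) : R :=
  (\prod_(n <- nm.1) rhat w n) * (\prod_(n <- nm.2) rhat w n) /
  (\prod_(n <- nm.1) n)%N%:R.

Lemma powR_prod (I : finType) (F : I -> nat) (e : R) :
  (\prod_i F i)%N%:R `^ e = \prod_i (F i)%:R `^ e.
Proof.
elim/big_ind2 : _ => [|x y x' y' hx hy|//]; first by rewrite powR1.
by rewrite natrM powRM// hx hy.
Qed.

Lemma card_ffun_prod_powR_le k m N P : (0 < m)%N -> (0 < P)%N ->
  #|[pred g : {ffun 'I_k -> 'I_N} | (\prod_i g i)%N == P]|%:R <=
  (((k * m)`! * 2 ^ (k * m)) ^ (2 ^ (k * m)))%:R `^ (m%:R^-1) * P%:R `^ (m%:R^-1) :> R.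
Proof.
move=> m0 P0; set C2 := (_ ^ _)%N.
apply: (@le_trans _ _ (size (divisors P) ^ k)%:R).
  by rewrite ler_nat card_ffun_prod_le.
rewrite -powRM//; have := @size_divisors_le (k * m) P P0; rewrite -/C2 expnM.
set D := (_ ^ k)%N => hD.
have -> : D%:R = (D ^ m)%:R `^ (m%:R^-1) :> R.
  by rewrite natrX -powR_mulrn// -powRrM divff ?powRr1// pnatr_eq0 -lt0n.
by rewrite ge0_ler_powR ?nnegrE ?invr_ge0// -natrM ler_nat.
Qed.

(** For a fixed f the number of g with the same product P is at most a constant
    times P ^ (1 / m).  Since both P and its power are products over the entries
    of f, the remaining sum over f is a k-th power. *)
Lemma sum_ffun_prod_eq_le k m N (h : nat -> R) : (0 < m)%N ->
    (forall n, 0 <= h n) ->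
  \sum_(f : {ffun 'I_k -> 'I_N})
    \sum_(g : {ffun 'I_k -> 'I_N} | (\prod_i f i == \prod_i g i)%N &&
       (0 < \prod_i f i)%N)
    (\prod_i h (f i) / (\prod_i f i)%N%:R) <=
  (((k * m)`! * 2 ^ (k * m)) ^ (2 ^ (k * m)))%:R `^ (m%:R^-1) *
  (\sum_(1 <= n < N) h n * n%:R `^ (m%:R^-1) / n%:R) ^+ k.
Proof.
move=> m0 h0; set C := _ `^ _; set e := m%:R^-1.
have C0 : 0 <= C by exact: powR_ge0.
have e0 : e != 0 by rewrite invr_neq0// pnatr_eq0 -lt0n.
apply: (@le_trans _ _ (\sum_(f : {ffun 'I_k -> 'I_N})
   C * \prod_i (h (f i) * (f i)%:R `^ e / (f i)%:R))).
  apply: ler_sum => f _.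
  have [Pf0|Pf0] := posnP (\prod_i f i)%N.
    rewrite big1 ?mulr_ge0 ?prodr_ge0// => [i _|g]; last by rewrite andbF.
    by rewrite divr_ge0// mulr_ge0// powR_ge0.
  rewrite (eq_bigl (fun g : {ffun 'I_k -> 'I_N} => (\prod_i g i)%N == (\prod_i f i)%N)); last first.
    by move=> g; rewrite andbT eq_sym.
  rewrite sumr_const -(mulr_natr _ #|_|).
  have -> : \prod_i (h (f i) * (f i)%:R `^ e / (f i)%:R) =
     (\prod_i h (f i) / (\prod_i f i)%N%:R) * (\prod_i f i)%N%:R `^ e.
    rewrite powR_prod !natr_prod -prodfV -!big_split.
    by apply: eq_bigr => i _ /=; rewrite mulrAC.
  rewrite [leRHS]mulrCA ler_wpM2l ?divr_ge0 ?prodr_ge0//.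
  exact: (@card_ffun_prod_powR_le k m N _ m0 Pf0).
rewrite -mulr_sumr ler_wpM2l//.
rewrite -(bigA_distr_bigA (fun _ (j : 'I_N) => h j * j%:R `^ e / j%:R)).
rewrite prodr_const card_ord lerXn2r ?nnegrE//.
- by rewrite sumr_ge0// => i _; rewrite divr_ge0// mulr_ge0// powR_ge0.
- by rewrite sumr_ge0// => i _; rewrite divr_ge0// mulr_ge0// powR_ge0.
rewrite -(big_mkord xpredT (fun j => h j * j%:R `^ e / j%:R)).
case: N => [|N]; first by rewrite !big_geq.
by rewrite [leLHS]big_ltn//= mulr0n invr0 mulr0 add0r.
Qed.

(** By x y <= (x ^ 2 + y ^ 2) / 2 the two tuples are decoupled, and the two halves
    are equal by the symmetry of the condition on (f, g). *)
Lemma sum_ffun_coef_le k m N w : (0 < m)%N ->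
  \sum_(p : {ffun 'I_k -> 'I_N} * {ffun 'I_k -> 'I_N} |
     (\prod_i p.1 i == \prod_i p.2 i)%N && (0 < \prod_i p.1 i)%N)
    (`|\prod_i rhat w (p.1 i)| * `|\prod_i rhat w (p.2 i)| / (\prod_i p.1 i)%N%:R) <=
  (((k * m)`! * 2 ^ (k * m)) ^ (2 ^ (k * m)))%:R `^ (m%:R^-1) *
  (\sum_(1 <= n < N) rhat w n ^+ 2 * n%:R `^ (m%:R^-1) / n%:R) ^+ k.
Proof.
move=> m0; set Q := leRHS.
pose h n := rhat w n ^+ 2.
have h0 n : 0 <= h n by exact: sqr_ge0.
have hQ := @sum_ffun_prod_eq_le k m N h m0 h0; rewrite -/Q in hQ.
pose A (f : {ffun 'I_k -> 'I_N}) : R := \prod_i h (f i) / (\prod_i f i)%N%:R.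
pose D (f g : {ffun 'I_k -> 'I_N}) := (\prod_i f i == \prod_i g i)%N && (0 < \prod_i f i)%N.
have hQ' : \sum_f \sum_(g | D f g) A g <= Q.
  rewrite (exchange_big_dep xpredT)//= (le_trans _ hQ)// ler_sum// => f _.
  rewrite (eq_bigl (D f))// => g; rewrite /D eq_sym.
  by case: eqVneq => //= ->.
rewrite -(pair_big_dep xpredT D (fun f g => `|\prod_i rhat w (f i)| * `|\prod_i rhat w (g i)| / (\prod_i f i)%N%:R)) /=.
apply: (@le_trans _ _ (\sum_f \sum_(g | D f g) (A f + A g) / 2)).
  apply: ler_sum => f _; apply: ler_sum => g /andP[/eqP fg _].
  rewrite /A -fg -mulrDl [leRHS]mulrAC ler_wpM2r ?invr_ge0//.
  rewrite /h !prodrXl; set x := \prod_i _; set y := \prod_i _.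
  have := sqr_ge0 (`|x| - `|y|); rewrite sqrrB !real_normK ?num_real//.
  by rewrite -mulr_natl; lra.
under eq_bigr do rewrite -mulr_suml big_split/=.
rewrite -mulr_suml big_split/=.
have : \sum_f \sum_(g | D f g) A f <= Q by exact: hQ.
move: hQ'; lra.
Qed.

End coefficients.

(** * Absolute summability, with control as the width tends to 0 *)

Section summability.
Context {R : realType}.
Implicit Types (w : R) (n N k m B : nat).

Lemma esum_le_of_finite (I : choiceType) (A : set I) (a : I -> R) (c : R) :
    (forall s : seq I, uniq s -> (forall i, i \in s -> A i) -> \sum_(i <- s) a i <= c) ->
  (\esum_(i in A) (a i)%:E <= c%:E)%E.
Proof.
move=> h; apply: ge_ereal_sup => _ [X [Xfin XA] <-].
rewrite fsbig_finite//= sumEFin lee_fin h ?fset_uniq// => i.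
by rewrite in_fset_set// inE => /XA.
Qed.

Lemma seq_tuples_bounded k (s : seq (k.-tuple nat * k.-tuple nat)) :
  exists N, forall nm, nm \in s ->
    (forall n, n \in val nm.1 -> (n < N)%N) /\ (forall n, n \in val nm.2 -> (n < N)%N).
Proof.
elim: s => [|[u v] s [N hN]]; first by exists 0%N.
exists (N + \max_(n <- u) n + \max_(n <- v) n).+1 => nm.
have maxP (t : seq nat) n : n \in t -> (n <= \max_(n <- t) n)%N.
  by move=> nt; apply: leq_bigmax_seq.
rewrite in_cons => /predU1P[->|/hN[h1 h2]]; split => n /=.
- by move=> /maxP; lia.
- by move=> /maxP; lia.
- by move=> /h1; lia.
- by move=> /h2; lia.
Qed.

Lemma sum_coef_le k m w (s : seq (k.-tuple nat * k.-tuple nat)) : (0 < m)%N ->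
    uniq s -> (forall nm, nm \in s -> D_index k nm) ->
  exists N, \sum_(nm <- s) `|coef w nm| <=
  (((k * m)`! * 2 ^ (k * m)) ^ (2 ^ (k * m)))%:R `^ (m%:R^-1) *
  (\sum_(1 <= n < N) rhat w n ^+ 2 * n%:R `^ (m%:R^-1) / n%:R) ^+ k.
Proof.
move=> m0 s_uniq sD; have [N hN] := seq_tuples_bounded s; exists N.
apply: le_trans (sum_ffun_coef_le k N w m0).
pose T (p : {ffun 'I_k -> 'I_N} * {ffun 'I_k -> 'I_N}) :=
  ([tuple val (p.1 i) | i < k], [tuple val (p.2 i) | i < k]).
rewrite -[leRHS]big_filter; set t := (X in _ <= \sum_(_ <- X) _).
have TE (F : nat -> R) (f : {ffun 'I_k -> 'I_N}) :
    \prod_(n <- [tuple val (f i) | i < k]) F n = \prod_i F (f i).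
  by rewrite big_tuple; apply: eq_bigr => i _; rewrite tnth_mktuple.
have TEn (f : {ffun 'I_k -> 'I_N}) :
    (\prod_(n <- [tuple val (f i) | i < k]) n = \prod_i f i)%N.
  by rewrite big_tuple; apply: eq_bigr => i _; rewrite tnth_mktuple.
rewrite [leRHS](_ : _ = \sum_(nm <- map T t) `|coef w nm|); last first.
  rewrite big_map; apply: eq_bigr => p _; rewrite /coef /= !TE !TEn.
  by rewrite normrM normfV normrM normr_nat.
apply: ler_sum_subset => // nm nms.
have [h1 h2] := hN nm nms.
have ex (u : k.-tuple nat) : (forall n, n \in val u -> (n < N)%N) ->
    exists f : {ffun 'I_k -> 'I_N}, [tuple val (f i) | i < k] = u.
  move=> hu; exists [ffun i => Ordinal (hu _ (mem_tnth i u))].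
  by apply: eq_from_tnth => i; rewrite tnth_mktuple ffunE.
have [f hf] := ex _ h1; have [g hg] := ex _ h2.
have Tfg : nm = T (f, g) by rewrite /T /= hf hg; case: nm {nms h1 h2 hf hg}.
rewrite Tfg map_f// mem_filter mem_index_enum andbT /=.
have [/allP p1 /allP p2] := sD _ nms.
rewrite -(TEn f) -(TEn g) hf hg => ->; rewrite eqxx /=.
by rewrite big_seq prodn_cond_gt0.
Qed.

(** The bound C / sqrt w is integrable near w = 0, which is what the averaging
    over w in the proof of [exists_VO2k_neq0] needs.  For that the exponent 1 / m
    of the divisor bound is taken so small that the k-th power of
    [weighted_sum_le] grows at most like w ^ (- 1 / 1378). *)
Lemma esum_coef_le k : (0 < k)%N -> exists2 C : R, 0 <= C &
  forall w, 0 < w -> w < 2 * pi ->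
    (\esum_(nm in D_index k) `|coef w nm|%:E <= (C / Num.sqrt w)%:E)%E.
Proof.
move=> k0; pose m := (2 * k * 1378)%N.
have m0 : (0 < m)%N by rewrite /m; lia.
have hm : (2756 <= m)%N by rewrite /m; nia.
pose C1 : R := (((k * m)`! * 2 ^ (k * m)) ^ (2 ^ (k * m)))%:R `^ (m%:R^-1).
have C10 : 0 <= C1 by exact: powR_ge0.
have hC1 w s := @sum_coef_le k m w s m0; rewrite -/C1 in hC1.
have mE : m%:R^-1 * (2 * k)%:R = 1378^-1 :> R.
  rewrite /m [in LHS]natrM invfM mulrAC mulVf ?mul1r// pnatr_eq0; lia.
have hq w B N := @weighted_sum_le R m w B N hm.
pose q : R := m%:R + 2917; rewrite -/q in hq.
have q0 : 0 <= q by rewrite addr_ge0 ?ler0n.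
(* C1 and q contain large numerals, which must not be unfolded *)
clearbody C1 m q.
have pi0 := @pi_gt0 R.
exists (C1 * q ^+ k * Num.sqrt (4 * pi)).
  by rewrite mulr_ge0 ?sqrtr_ge0// mulr_ge0// exprn_ge0.
move=> w w0 w2; set B := (Num.truncn (2 * pi / w)).+1.
have /andP[B1 B2] : (B.-1%:R <= 2 * pi / w < B%:R).
  by apply: truncn_itv; rewrite divr_ge0 ?mulr_ge0// ltW.
have BS : B%:R = B.-1%:R + 1 :> R by rewrite natr1.
have hB1 : 2 * pi <= w * B%:R.
  by move: B2; rewrite ltr_pdivrMr// [w * _]mulrC => /ltW.
have hB2 : w * B%:R <= 4 * pi.
  move: B1; rewrite ler_pdivlMr// BS; lra.
have B_ge1 : 1 <= B%:R :> R by rewrite ler1n.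
apply: esum_le_of_finite => s s_uniq sD.
have [N hN] := hC1 w s s_uniq sD.
apply: le_trans hN _; rewrite -!mulrA ler_wpM2l//.
apply: (@le_trans _ _ ((q * (B%:R `^ (m%:R^-1)) ^+ 2) ^+ k)).
  rewrite lerXn2r ?nnegrE//.
  - rewrite sumr_ge0// => n _; rewrite divr_ge0// mulr_ge0 ?sqr_ge0 ?powR_ge0//.
  - by apply: mulr_ge0 => //; rewrite exprn_ge0// powR_ge0.
  - exact: hq.
rewrite exprMn ler_wpM2l ?exprn_ge0//.
rewrite -exprM -powR_mulrn ?powR_ge0// -powRrM.
rewrite mE.
apply: (@le_trans _ _ (B%:R `^ 2^-1)).
  by rewrite ler_powR//; lra.
rewrite powR12_sqrt// -(sqrtrV (ltW w0)) -sqrtrM; last by rewrite mulr_ge0// ltW.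
by apply: ler_wsqrtr; rewrite ler_pdivlMr// mulrC.
Qed.

End summability.

(** * Fourier transform of the Cantor measure *)

Section cantor_fourier.
Context {R : realType}.
Implicit Types (s t x : R) (n m J : nat).

(** The value of [cantor_step J] on the m-th dyadic interval of length 2 ^ (- J):
    the binary digits of m, doubled, read in base 3. *)
Fixpoint ternary J m : R :=
  if J is J'.+1 then ternary J' m./2 + 2 * (odd m)%:R / 3 ^+ J else 0.

(** The partial sums of the series that defines [cantor_map]. *)
Definition cantor_step J x : R :=
  series (fun j => 2 * bin_digit j x / 3 ^+ j.+1) J.

Lemma sum_nat_double (F : nat -> R) N :
  \sum_(0 <= m < 2 * N) F m = \sum_(0 <= m < N) (F (2 * m)%N + F (2 * m).+1).
Proof.
elim: N => [|N IHN]; first by rewrite !big_geq.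
by rewrite mulnS addnC addn2 !big_nat_recr//= IHN addrA.
Qed.

Lemma ternary_double J m : ternary J.+1 (2 * m) = ternary J m.
Proof. by rewrite /= mul2n doubleK odd_double mulr0 mul0r addr0. Qed.

Lemma ternary_doubleS J m :
  ternary J.+1 (2 * m).+1 = ternary J m + 2 / 3 ^+ J.+1.
Proof. by rewrite /= mul2n uphalf_double odd_double mulr1. Qed.

(** A new ternary digit replaces each phase A by the pair A, A + 2 v with
    v = t / 3 ^ (J + 1), and cos A + cos (A + 2 v) = 2 cos v cos (A + v): this
    produces the next cosine factor and shifts the phase towards t / 2. *)
Lemma sum_cos_ternary J s t :
  \sum_(0 <= m < 2 ^ J) cos (s + t * ternary J m) =
  2 ^+ J * (cos (s + t * ((1 - 3^-1 ^+ J) / 2)) * cosprod t J).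
Proof.
elim: J s => [|J IHJ] s.
  by rewrite expn0 big_nat1 /= cosprod0 !expr0 subrr mul0r mulr0 addr0 mul1r mulr1.
rewrite expnS sum_nat_double.
have two_cos (u v : R) : cos u + cos (u + 2 * v) = 2 * cos v * cos (u + v).
  have -> : cos u = cos ((u + v) - v) by congr cos; ring.
  have -> : cos (u + 2 * v) = cos ((u + v) + v) by congr cos; ring.
  by rewrite cosB (cosD (u + v) v); ring.
under eq_bigr => m _.
  rewrite ternary_double ternary_doubleS.
  set q := 3 ^+ J.+1.
  have -> : s + t * (ternary J m + 2 / q) =
    (s + t * ternary J m) + 2 * (t / q) by ring.
  rewrite two_cos (addrAC s).
  over.
rewrite -mulr_sumr IHJ cosprodS.
have -> : s + t / 3 ^+ J.+1 + t * ((1 - 3^-1 ^+ J) / 2) =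
   s + t * ((1 - 3^-1 ^+ J.+1) / 2).
  rewrite !exprVn exprS; set q := 3 ^+ J; have : q != 0 by rewrite expf_neq0.
  by move=> q0; field.
rewrite [2 ^+ J.+1]exprS; set q := 3 ^+ J.+1; set r := 2 ^+ J; ring.
Qed.

Lemma cantor_step_ternary J m x :
    m%:R <= 2 ^+ J * x -> 2 ^+ J * x < m.+1%:R ->
  cantor_step J x = ternary J m.
Proof.
rewrite /cantor_step; elim: J m => [|J IHJ] m h1 h2.
  by rewrite /series/= big_geq.
rewrite seriesSr.
have hm : m = (odd m + m./2.*2)%N by rewrite odd_double_half.
have ho : (odd m)%:R <= 1 :> R by rewrite lern1 leq_b1.
have ho0 : 0 <= (odd m)%:R :> R by [].
have hmR : m%:R = (odd m)%:R + 2 * (m./2)%:R :> R.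
  by rewrite {1}hm natrD -mul2n natrM.
have h1' : (m./2)%:R <= 2 ^+ J * x.
  by move: h1; rewrite hmR exprS -mulrA; lra.
have h2' : 2 ^+ J * x < (m./2).+1%:R.
  by move: h2; rewrite -!natr1 hmR exprS -mulrA; lra.
rewrite (IHJ m./2)//; congr (_ + 2 * _ / _).
rewrite /bin_digit.
have floorE (y : R) k : k%:R <= y -> y < k.+1%:R -> (Num.floor y)%:~R = k%:R :> R.
  move=> y1 y2; rewrite (@floor_def _ y k%:Z)// y1 intrD.
  by rewrite natr1.
by rewrite (floorE _ m)// (floorE _ m./2)// hmR addrK.
Qed.

Lemma measurable_cantor_step J : measurable_fun setT (cantor_step J : R -> R).
Proof.
apply: measurable_sum => j; apply: measurable_funM => //.
by apply: measurable_funM => //; exact: measurable_bin_digit.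
Qed.

Lemma measurable_cos_affine s t (f : R -> R) :
  measurable_fun setT f -> measurable_fun setT (fun x => cos (s + t * f x)).
Proof.
move=> mf; apply: (measurableT_comp (f := cos)).
  by apply: continuous_measurable_fun => x; exact: continuous_cos.
by apply: measurable_funD => //; apply: measurable_funM.
Qed.

Lemma integral_dyadic_step J M (f : R -> R) (h : nat -> R) :
    measurable_fun setT f -> (forall m, 0 <= h m) ->
    (forall m x, m%:R <= 2 ^+ J * x -> 2 ^+ J * x < m.+1%:R -> f x = h m) ->
  (\int[lebesgue_measure]_(x in `[0%R, (M%:R / 2 ^+ J)%R[) (f x)%:E =
   (2^-1 ^+ J * \sum_(0 <= m < M) h m)%:E)%E.
Proof.
move=> mf h0 fh; have J0 : 0 < 2 ^+ J :> R by rewrite exprn_gt0.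
elim: M => [|M IHM].
  by rewrite mul0r set_itvco0 integral_set0 big_geq// mulr0.
have -> : `[0, (M.+1%:R / 2 ^+ J)[%classic =
   `[0, (M%:R / 2 ^+ J)[%classic `|` `[(M%:R / 2 ^+ J), (M.+1%:R / 2 ^+ J)[%classic :> set R.
  rewrite -itv_bndbnd_setU// bnd_simp ?divr_ge0 ?exprn_ge0//.
  by rewrite ler_pM2r ?invr_gt0// ler_nat.
have itvE (x : R) m : `[(m%:R / 2 ^+ J), (m.+1%:R / 2 ^+ J)[%classic x ->
    f x = h m.
  rewrite /= in_itv/= ler_pdivrMr// ltr_pdivlMr// mulrC => /andP[h1 h2].
  exact: fh.
have f0 (x : R) : 0 <= x -> 0 <= f x.
  move=> x0; have /truncn_itv/andP[h1 h2] : 0 <= 2 ^+ J * x by rewrite mulr_ge0// ltW.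
  by rewrite (fh _ _ h1 h2).
rewrite ge0_integral_setU//=; last 3 first.
- by apply/measurable_EFinP; exact: measurable_funTS.
- move=> x; rewrite /= !in_itv/= lee_fin => -[/andP[x0 _]|/andP[x0 _]]; apply: f0 => //.
  by rewrite (le_trans _ x0)// divr_ge0// ltW.
- apply/disj_setPS => x; rewrite /= !in_itv/= => -[/andP[_ h1] /andP[h2 _]].
  by move: (lt_le_trans h1 h2); rewrite ltxx.
rewrite IHM (eq_integral (fun=> (h M)%:E)); last first.
  by move=> x; rewrite inE => /itvE ->.
rewrite integral_cst//= lebesgue_measure_itv/= lte_fin ltr_pM2r ?invr_gt0//.
rewrite ltr_nat ltnS leqnn -EFinB -EFinM -EFinD; congr _%:E.
rewrite big_nat_recr//= [RHS]mulrDr -mulrBl -natrB// subSnn mul1r exprVn.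
by rewrite [h M * _]mulrC.
Qed.

Local Notation U := (uniform_prob (@ltr01 R)).

Lemma bounded_integrable_probability d (T : measurableType d)
    (P : probability T R) (f : T -> R) (c : R) :
  measurable_fun setT f -> (forall z, `|f z| <= c) ->
  P.-integrable setT (EFin \o f).
Proof.
move=> mf fc; apply: measurable_bounded_integrable => //.
  by rewrite (le_lt_trans (probability_le1 _ _))// ltry.
exists c; split; first exact: num_real.
by move=> y cy x _ /=; rewrite (le_trans (fc x))// ltW.
Qed.

(** Since 1 + cos is nonnegative, its integral can be cut along the 2 ^ J dyadic
    intervals, on each of which [cantor_step] is constant. *)
Lemma integral_cos_cantor_step J s t :
  \int[U]_x cos (s + t * cantor_step J x) =
  cos (s + t * ((1 - 3^-1 ^+ J) / 2)) * cosprod t J.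
Proof.
have mf := measurable_cos_affine s t (measurable_cantor_step J).
have h1 : (\int[U]_x (1 + cos (s + t * cantor_step J x))%:E =
    (2^-1 ^+ J * \sum_(0 <= m < 2 ^ J) (1 + cos (s + t * ternary J m)))%:E)%E.
  rewrite integral_uniform; last 2 first.
  - by apply/measurable_EFinP; apply: measurable_funD.
  - by move=> x; rewrite lee_fin -lerBlDl sub0r cos_geN1.
  rewrite subr0 invr1 mul1e -integral_itv_bndo_bndc; last first.
    by apply: measurable_funTS; apply/measurable_EFinP; apply: measurable_funD.
  have := @integral_dyadic_step J (2 ^ J)%N
    (fun x => 1 + cos (s + t * cantor_step J x))
    (fun m => 1 + cos (s + t * ternary J m)).
  rewrite natrX divff ?expf_neq0// => -> //.
  - by apply: measurable_funD.
  - by move=> m x hm1 hm2; rewrite (cantor_step_ternary hm1 hm2).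
have h2 : \int[U]_x (1 + cos (s + t * cantor_step J x)) =
    1 + \int[U]_x cos (s + t * cantor_step J x).
  rewrite RintegralD//=; last 2 first.
  - by apply: (@bounded_integrable_probability _ _ _ _ 1) => // z; rewrite normr1.
  - by apply: (@bounded_integrable_probability _ _ _ _ 1) => // x; exact: cos_max.
  by rewrite Rintegral_cst//= probability_setT mulr1.
apply: (addrI 1); rewrite -h2 /Rintegral h1 /= big_split/= mulrDr sum_cos_ternary.
have e : 2^-1 ^+ J * 2 ^+ J = 1 :> R by rewrite -exprMn mulVf// expr1n.
by rewrite sumr_const_nat subn0 natrX e; set y := cos _ * _; rewrite mulrA e mul1r.
Qed.

Lemma integral_cos_cantor_map s t :
  \int[U]_x cos (s + t * cantor_map x) = cos (s + t / 2) * limn (cosprod t).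
Proof.
have [//||||||_ _ hcvg] := @dominated_convergence _ _ R U setT _
  (fun J x => (cos (s + t * cantor_step J x))%:E)
  (fun x => (cos (s + t * cantor_map x))%:E) (cst 1%:E).
- move=> J; apply/measurable_EFinP; apply: measurable_cos_affine.
  exact: measurable_cantor_step.
- apply/measurable_EFinP; apply: measurable_cos_affine.
  exact: measurable_cantor_map.
- apply: aeW => x _; apply: cvg_EFin; first exact: nearW.
  have hc : (fun J => cos (s + t * cantor_step J x)) @ \oo --> cos (s + t * cantor_map x).
    apply: continuous_cvg; first exact: continuous_cos.
    by apply: cvgD; [exact: cvg_cst|apply: cvgMl_tmp; exact: cantor_map_cvg].
  exact: hc.
- by apply: (@bounded_integrable_probability _ _ _ (cst 1) 1) => // z; rewrite normr1.
- by apply: aeW => x J _; rewrite lee_fin cos_max.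
have h1 : (fun J => \int[U]_x cos (s + t * cantor_step J x)) @ \oo -->
    \int[U]_x cos (s + t * cantor_map x).
  apply: fine_cvg; rewrite /Rintegral fineK; first exact: hcvg.
  apply: integrable_fin_num => //.
  apply: (@bounded_integrable_probability _ _ _ _ 1).
    by apply: measurable_cos_affine; exact: measurable_cantor_map.
  by move=> x; exact: cos_max.
have h2 : (fun J => \int[U]_x cos (s + t * cantor_step J x)) @ \oo -->
    cos (s + t / 2) * limn (cosprod t).
  under eq_fun do rewrite integral_cos_cantor_step.
  have -> : s + t / 2 = s + t * ((1 - 0) / 2) by rewrite subr0 mul1r.
  apply: cvgM; last exact: is_cvg_cosprod.
  apply: continuous_cvg; first exact: continuous_cos.
  apply: cvgD; first exact: cvg_cst.
  apply: cvgMl_tmp; apply: cvgMr_tmp; apply: cvgB; first exact: cvg_cst.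
  by apply: cvg_expr; rewrite ger0_norm// invf_lt1// ltr1n.
exact: (cvg_unique _ h1 h2).
Qed.

End cantor_fourier.

(** * The terms as phases *)

Section nuhat_formula.
Context {R : realType}.
Implicit Types (s t a b w phi : R) (n m k : nat).

Lemma integral_cos_cantor_measure_on a b s t :
  \int[cantor_measure_on a b]_x cos (s + t * x) =
  cos (s + t * a + t * (b - a) / 2) * limn (cosprod (t * (b - a))).
Proof.
rewrite -integral_cos_cantor_map /Rintegral; congr fine.
have mc : measurable_fun setT (fun x : R => (cos (s + t * x))%:E).
  by apply/measurable_EFinP; apply: (measurable_cos_affine s t (f := id)).
have I1 : (@cantor_measure R).-integrable setT
    (EFin \o (fun x => cos (s + t * affine_on a b x))).
  apply: (@bounded_integrable_probability _ _ _ _ (fun x => cos (s + t * affine_on a b x)) 1).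
    by apply: measurable_cos_affine; exact: measurable_affine_on.
  by move=> z; exact: cos_max.
have I2 : (uniform_prob (@ltr01 R)).-integrable setT
    (EFin \o (fun x => cos (s + t * affine_on a b (cantor_map x)))).
  apply: (@bounded_integrable_probability _ _ _ _
    (fun x : measurableTypeR R => cos (s + t * affine_on a b (cantor_map x))) 1).
    apply: (measurable_cos_affine s t (f := fun x => affine_on a b (cantor_map x))).
    by apply: measurableT_comp; [exact: measurable_affine_on|exact: measurable_cantor_map].
  by move=> z; exact: cos_max.
rewrite integral_distribution//.
rewrite integral_distribution//; last first.
  apply/measurable_EFinP; apply: (measurable_cos_affine s t (f := affine_on a b)).
  exact: measurable_affine_on.
apply: eq_integral => x _ /=; congr (cos _)%:E.
rewrite /cantor_rv /affine_on; ring.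
Qed.

Lemma nuhatE w phi n : nuhat w phi n = expi (n%:R * phi) * (rhat w n)%:C.
Proof.
have h s : \int[cantor_measure_on (phi - w / 2) (phi + w / 2)]_x cos (s + n%:R * x) =
    cos (s + n%:R * phi) * rhat w n.
  rewrite integral_cos_cantor_measure_on rhatE.
  have -> : phi + w / 2 - (phi - w / 2) = w by field.
  by rewrite [n%:R * w]mulrC; congr (cos _ * _); field.
rewrite /nuhat /cintegral /expi /=.
apply/eqP; rewrite eq_complex /= !mulr0 subr0 add0r; apply/andP; split; apply/eqP.
  have := h 0; rewrite add0r => <-.
  by apply: eq_Rintegral => x _; rewrite add0r.
have := h (- (pi / 2)); rewrite (addrC _ (n%:R * phi)) cosBpihalf => <-.
by apply: eq_Rintegral => x _; rewrite (addrC _ (n%:R * x)) cosBpihalf.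
Qed.

Lemma expiD s t : expi (s + t) = expi s * expi t.
Proof.
by apply/eqP; rewrite eq_complex /= cosD sinD eqxx /= addrC [sin s * _]mulrC
  [cos s * sin t + _]addrC eqxx.
Qed.

Lemma expi0 : expi 0 = 1 :> R[i].
Proof. by rewrite /expi cos0 sin0. Qed.

Lemma conjc_expiM s t : conjc (expi s * t%:C) = expi (- s) * t%:C.
Proof.
by apply/eqP; rewrite eq_complex /= cosN sinN !mulr0 !add0r !subr0 mulNr !eqxx.
Qed.

Lemma prod_nuhat w phi (s : seq nat) :
  \prod_(n <- s) nuhat w phi n =
  expi ((\sum_(n <- s) n)%N%:R * phi) * (\prod_(n <- s) rhat w n)%:C.
Proof.
elim: s => [|n s IHs]; first by rewrite !big_nil mul0r expi0 mul1r.
rewrite !big_cons IHs nuhatE natrD mulrDl expiD rmorphM /=.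
by rewrite mulrACA.
Qed.

(** The coefficient of the centre in the phase of the term of index [nm]. *)
Definition frequency k (nm : k.-tuple nat * k.-tuple nat) : R :=
  (\sum_(n <- nm.1) n)%N%:R - (\sum_(n <- nm.2) n)%N%:R.

Lemma D_termE w k phi (nm : k.-tuple nat * k.-tuple nat) :
  D_term w k phi nm = expi (frequency nm * phi) * (coef w nm)%:C.
Proof.
rewrite /D_term !prod_nuhat conjc_expiM mulrACA -expiD -mulNr -mulrDl -!mulrA.
by rewrite /coef !rmorphM/= fmorphV /= rmorph_nat -!mulrA.
Qed.

Lemma Re_D_term w k phi (nm : k.-tuple nat * k.-tuple nat) :
  complex.Re (D_term w k phi nm) = coef w nm * cos (frequency nm * phi).
Proof. by rewrite D_termE /= mulr0 subr0 mulrC. Qed.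

Lemma Im_D_term w k phi (nm : k.-tuple nat * k.-tuple nat) :
  complex.Im (D_term w k phi nm) = coef w nm * sin (frequency nm * phi).
Proof. by rewrite D_termE /= mulr0 add0r mulrC. Qed.

End nuhat_formula.

(** * Absolutely summable families *)

Section real_sums.
Context {R : realType}.
Local Notation pos f := (fun i => Num.max (f i) 0).
Local Notation neg f := (fun i => Num.max (- f i) 0).

Section choice.
Context {I : choiceType}.
Implicit Types (A B : set I) (f g h : I -> R).

Definition abs_summable A f : Prop := (\esum_(i in A) `|f i|%:E < +oo)%E.

Lemma rsumE A f : rsum A f =
  fine (\esum_(i in A) (pos f i)%:E) - fine (\esum_(i in A) (neg f i)%:E).
Proof.
rewrite /rsum; congr (fine _ - fine _); apply: eq_esum => i _.
  by rewrite funeposE /= EFin_max.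
by rewrite funenegE /= EFin_max.
Qed.

Lemma abs_summable_le A f g : (forall i, A i -> `|f i| <= `|g i|) ->
  abs_summable A g -> abs_summable A f.
Proof.
by move=> fg; apply: le_lt_trans; apply: le_esum => i Ai; rewrite lee_fin fg.
Qed.

Lemma pos_ge0 f i : 0 <= pos f i. Proof. by rewrite le_max lexx orbT. Qed.
Lemma pos_le f i : pos f i <= `|f i|.
Proof. by rewrite ge_max normr_ge0 ler_norm. Qed.
Lemma posBneg f i : pos f i - neg f i = f i.
Proof.
rewrite /=; have /orP[h|h] := le_total 0 (f i).
  by rewrite max_l// max_r ?oppr_le0// subr0.
by rewrite max_r// max_l ?oppr_ge0// sub0r opprK.
Qed.

Lemma fin_num_esum A f : (forall i, A i -> 0 <= f i) -> abs_summable A f ->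
  \esum_(i in A) (f i)%:E \is a fin_num.
Proof.
move=> f0 fs; rewrite ge0_fin_numE; last by apply: esum_ge0 => i /f0; rewrite lee_fin.
apply: le_lt_trans fs; by apply: le_esum => i Ai; rewrite lee_fin ler_norm.
Qed.

Lemma abs_summable_pos A f : abs_summable A f -> abs_summable A (pos f).
Proof.
by apply: abs_summable_le => i _; rewrite [leLHS]ger0_norm ?pos_ge0// pos_le.
Qed.

Lemma abs_summable_neg A f : abs_summable A f -> abs_summable A (neg f).
Proof.
move=> fs; apply: (@abs_summable_pos A (fun i => - f i)).
by apply: abs_summable_le fs => i _; rewrite normrN.
Qed.

Lemma abs_summable_sub A B f : A `<=` B -> abs_summable B f -> abs_summable A f.
Proof.
move=> AB; apply: le_lt_trans.
rewrite esum_mkcond [leRHS]esum_mkcond; apply: le_esum => i _.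
case: ifPn => [|_]; last by case: ifP.
by rewrite inE => /AB Bi; rewrite mem_set.
Qed.

Lemma abs_summableB A f g : abs_summable A f -> abs_summable A g ->
  abs_summable A (fun i => f i - g i).
Proof.
move=> fs gs; apply: (@le_lt_trans _ _ (\esum_(i in A) (`|f i|%:E + `|g i|%:E))).
  by apply: le_esum => i _; rewrite -EFinD lee_fin ler_normB.
by rewrite esumD ?lte_add_pinfty// => i _; rewrite lee_fin.
Qed.

Lemma eq_rsum A f g : (forall i, A i -> f i = g i) -> rsum A f = rsum A g.
Proof.
by move=> fg; rewrite !rsumE; congr (fine _ - fine _); apply: eq_esum => i Ai;
  rewrite fg.
Qed.

Lemma ge0_rsum A f : (forall i, A i -> 0 <= f i) ->
  rsum A f = fine (\esum_(i in A) (f i)%:E).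
Proof.
move=> f0; rewrite rsumE [X in _ - fine X]esum1 ?subr0; last first.
  by move=> i /f0 fi; rewrite max_r// oppr_le0.
by congr fine; apply: eq_esum => i /f0 fi; rewrite max_l.
Qed.

Lemma rsum_split A B f : abs_summable A f ->
  rsum A f = rsum (A `&` B) f + rsum (A `&` ~` B) f.
Proof.
move=> fs; rewrite !rsumE.
have h g : (forall i, 0 <= g i) -> abs_summable A g ->
    fine (\esum_(i in A) (g i)%:E) = fine (\esum_(i in A `&` B) (g i)%:E) +
      fine (\esum_(i in A `&` ~` B) (g i)%:E).
  move=> g0 gs; rewrite (esumID B); last by move=> i _; rewrite lee_fin.
  by rewrite fineD// fin_num_esum//; apply: abs_summable_sub gs; apply: subIsetl.
rewrite (h _ (pos_ge0 f) (abs_summable_pos fs)).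
rewrite (h _ (pos_ge0 (fun i => - f i)) (abs_summable_neg fs)).
ring.
Qed.

Lemma rsum0 A f : (forall i, A i -> f i = 0) -> rsum A f = 0.
Proof.
move=> f0; rewrite ge0_rsum; last by move=> i /f0 ->.
by rewrite esum1// => i /f0 ->.
Qed.

Lemma rsumB A g h : (forall i, A i -> 0 <= g i) -> (forall i, A i -> 0 <= h i) ->
    abs_summable A g -> abs_summable A h ->
  rsum A (fun i => g i - h i) =
  fine (\esum_(i in A) (g i)%:E) - fine (\esum_(i in A) (h i)%:E).
Proof.
move=> g0 h0 gs hs.
have := @esumB R I A (EFin \o g) (EFin \o h) gs hs g0 h0.
have gh := abs_summableB gs hs; set u := fun i => g i - h i in gh *.
have -> : ((EFin \o g) \- (EFin \o h))%E = EFin \o u by [].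
have e1 : \esum_(i in A) ((EFin \o u)^\+ i)%E = \esum_(i in A) (pos u i)%:E.
  by apply: eq_esum => i _; rewrite funeposE /= EFin_max.
have e2 : \esum_(i in A) ((EFin \o u)^\- i)%E = \esum_(i in A) (neg u i)%:E.
  by apply: eq_esum => i _; rewrite funenegE /= EFin_max.
rewrite rsumE e1 e2 => e.
have hg := fin_num_esum g0 gs; have hh := fin_num_esum h0 hs.
have hp := fin_num_esum (fun i _ => pos_ge0 _ i) (abs_summable_pos gh).
have hn := fin_num_esum (fun i _ => pos_ge0 (fun i => - u i) i) (abs_summable_neg gh).
by rewrite -!fineB// e.
Qed.

End choice.

Section grouping.
Context {I J : choiceType}.

Lemma esum_fibers (A : set I) (q : I -> J) (g : I -> R) :
    (forall i, A i -> 0 <= g i) ->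
  \esum_(i in A) (g i)%:E =
  \esum_(j in q @` A) \esum_(i in A `&` [set i | q i = j]) (g i)%:E.
Proof.
move=> g0; rewrite esum_esum; last by move=> j i _ [Ai _]; rewrite lee_fin g0.
apply/esym; apply: (@reindex_esum R I (J * I)%type A _ (fun i => (q i, i)) (fun k => (g k.2)%:E)).
split.
- by move=> i Ai; split => /=; [exists i|].
- by move=> i i' _ _ [].
- by move=> [j i] [/= _ [Ai <-]]; exists i.
Qed.

(** Summation by packets.  The index set B of the packets may be larger than the
    image of A, in which case the extra packets are empty. *)
Lemma rsum_fibers (A : set I) (q : I -> J) (B : set J) (f : I -> R) (F : J -> R) :
    abs_summable A f -> (forall i, A i -> B (q i)) ->
    (forall j, B j -> F j = rsum (A `&` [set i | q i = j]) f) ->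
  abs_summable B F /\ rsum A f = rsum B F.
Proof.
move=> fs AB Fq.
have pk (g : I -> R) : (forall i, 0 <= g i) -> abs_summable A g ->
    let G j := fine (\esum_(i in A `&` [set i | q i = j]) (g i)%:E) in
    [/\ forall j, 0 <= G j, abs_summable B G &
        \esum_(i in A) (g i)%:E = \esum_(j in B) (G j)%:E].
  move=> g0 gs G; have G0 j : 0 <= G j.
    by rewrite fine_ge0// esum_ge0// => i _; rewrite lee_fin.
  have GE j : (G j)%:E = \esum_(i in A `&` [set i | q i = j]) (g i)%:E.
    by rewrite fineK// fin_num_esum//; apply: abs_summable_sub gs; apply: subIsetl.
  have e : \esum_(i in A) (g i)%:E = \esum_(j in B) (G j)%:E.
    rewrite (esum_fibers q)// esum_mkcond [RHS]esum_mkcond.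
    apply: eq_esum => j _; rewrite -GE; case: ifPn => [|jA].
      by rewrite inE => -[i Ai <-]; rewrite mem_set//; exact: AB.
    case: ifPn => // _; apply/esym; rewrite GE esum1// => i [Ai /= qi].
    by move/negP: jA; case; rewrite inE; exists i.
  split => //; rewrite /abs_summable; under eq_esum do rewrite ger0_norm//.
  by rewrite -e -ge0_fin_numE ?fin_num_esum// esum_ge0// => i _; rewrite lee_fin.
have [P0 Ps Pe] := pk _ (pos_ge0 f) (abs_summable_pos fs).
have [N0 Ns Ne] := pk _ (pos_ge0 (fun i => - f i)) (abs_summable_neg fs).
set P := (fun j => fine _) in P0 Ps Pe.
set N := (fun j => fine _) in N0 Ns Ne.
have FE j : B j -> F j = P j - N j by move=> /Fq ->; rewrite rsumE.
split.
  have PN := abs_summableB Ps Ns.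
  by apply: abs_summable_le PN => j /FE ->.
by rewrite (rsumE A) Pe Ne (eq_rsum FE) rsumB// => j _; [exact: P0|exact: N0].
Qed.

End grouping.

Section enumeration.
Context {I : countType}.
Implicit Types (A : set I) (f g : I -> R).

(** [pickle_inv] enumerates every index exactly once, which turns a sum over a
    countable index type into a series. *)
Definition enumf A f (j : nat) : R :=
  if pickle_inv j is Some i then (if i \in A then f i else 0) else 0.

Lemma ge0_cvg_enumf A g : (forall i, 0 <= g i) -> abs_summable A g ->
  series (enumf A g) @ \oo --> fine (\esum_(i in A) (g i)%:E).
Proof.
move=> g0 gs; have G0 j : 0 <= enumf A g j.
  by rewrite /enumf; case: pickle_inv => // i; case: ifP.
have e : \esum_(i in A) (g i)%:E = (\sum_(0 <= j <oo) (enumf A g j)%:E)%E.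
  rewrite nneseries_esumT; last by move=> j; rewrite lee_fin.
  transitivity (\esum_(j in [set choice.pickle i | i in A]) (enumf A g j)%:E).
    rewrite esum_image; last by move=> i i' _ _; exact: (pcan_inj pickleK_inv).
    by apply: eq_esum => i Ai; rewrite /enumf pickleK_inv mem_set.
  rewrite esum_mkcond; apply: eq_esum => j _; case: ifPn => // jA.
  rewrite /enumf; case E : (pickle_inv j) => [i|//]; case: ifPn => // iA.
  move/negP: jA; case; rewrite inE; exists i; first by rewrite inE in iA.
  by have := @pickle_invK I j; rewrite E.
have gf : \esum_(i in A) (g i)%:E \is a fin_num by rewrite fin_num_esum.
have h : (fun n => (\sum_(0 <= j < n) (enumf A g j)%:E)%E) @ \oo -->
    (\sum_(0 <= j <oo) (enumf A g j)%:E)%E.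
  by apply: is_cvg_nneseries => j _ _; rewrite lee_fin.
rewrite -e -(fineK gf) in h; move/fine_cvgP : h => [_].
apply: cvg_trans; apply: near_eq_cvg; apply: nearW => n /=.
by rewrite sumEFin.
Qed.

Lemma enumfB A f g j : enumf A (fun i => f i - g i) j = enumf A f j - enumf A g j.
Proof.
by rewrite /enumf; case: pickle_inv => [i|]; [case: ifP|]; rewrite ?subr0.
Qed.

Lemma cvg_enumf A f : abs_summable A f -> series (enumf A f) @ \oo --> rsum A f.
Proof.
move=> fs; rewrite rsumE.
have -> : series (enumf A f) = (fun n =>
    series (enumf A (pos f)) n - series (enumf A (neg f)) n).
  apply/funext => n; rewrite !seriesEnat /= -sumrB; apply: eq_bigr => j _.
  by rewrite -enumfB; congr (enumf A _ j); apply/funext => i; rewrite posBneg.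
apply: cvgB; apply: ge0_cvg_enumf.
- exact: pos_ge0.
- exact: abs_summable_pos.
- exact: (pos_ge0 (fun i => - f i)).
- exact: abs_summable_neg.
Qed.

Lemma norm_series_enumf_le A f (c : R) n :
  (\esum_(i in A) `|f i|%:E <= c%:E)%E -> `|series (enumf A f) n| <= c.
Proof.
move=> fc; have fs : abs_summable A (fun i => `|f i|).
  rewrite /abs_summable; under eq_esum do rewrite normr_id.
  by rewrite (le_lt_trans fc)// ltry.
apply: le_trans (_ : series (enumf A (fun i => `|f i|)) n <= c).
  rewrite !seriesEnat /=; apply: le_trans (ler_norm_sum _ _ _) _.
  apply: ler_sum => j _; rewrite /enumf; case: pickle_inv => [i|]; last by rewrite normr0.
  by case: ifP; rewrite ?normr0.
have h := ge0_cvg_enumf (fun i => normr_ge0 (f i)) fs.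
apply: le_trans (_ : fine (\esum_(i in A) `|f i|%:E) <= c); last first.
  by rewrite -lee_fin fineK// fin_num_esum// => i _.
rewrite -(cvg_lim _ h)//; apply: nondecreasing_cvgn_le; last exact: cvgP h.
apply/nondecreasing_seqP => m; rewrite seriesSr lerDl /enumf.
by case: pickle_inv => // i; case: ifP.
Qed.

Lemma norm_le_of_esum A f (c : R) i : A i ->
  (\esum_(i in A) `|f i|%:E <= c%:E)%E -> `|f i| <= c.
Proof.
move=> Ai fc; rewrite -lee_fin; apply: le_trans fc; apply: esum_ge.
exists [set i]; last by rewrite fsbig_set1.
by split; [exact: finite_set1|move=> _ ->].
Qed.

End enumeration.

Section integration.
Context {I : countType} d (T : measurableType d) (mu : {measure set T -> \bar R}).

(** Dominated convergence for the partial sums of the enumerated family.  The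
    conclusion is a limit of partial sums and not the sum of the integrals, since
    the latter need not be known to be absolutely summable. *)
Lemma integral_rsum (A : set I) (E : set T) (f : I -> T -> R) (g : T -> R) :
    measurable E -> (forall i, A i -> measurable_fun E (f i)) ->
    mu.-integrable E (EFin \o g) ->
    (forall x, E x -> (\esum_(i in A) `|f i x|%:E <= (g x)%:E)%E) ->
  mu.-integrable E (fun x => (rsum A (f^~ x))%:E) /\
  series (enumf A (fun i => \int[mu]_(x in E) f i x)) @ \oo -->
    \int[mu]_(x in E) rsum A (f^~ x).
Proof.
move=> mE mf ig fg.
have fs x : E x -> abs_summable A (f^~ x).
  by move=> Ex; rewrite /abs_summable (le_lt_trans (fg x Ex))// ltry.
pose u j x := enumf A (f^~ x) j.
have mu_ j : measurable_fun E (u j).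
  rewrite /u /enumf; case: pickle_inv => [i|]; last exact: measurable_cst.
  by case: (boolP (i \in A)) => [|_]; [rewrite inE => /mf|exact: measurable_cst].
have mF n : measurable_fun E (fun x => series (u^~ x) n).
  by apply: measurable_sum => j; exact: mu_.
have cF x : E x -> (fun n => series (u^~ x) n) @ \oo --> rsum A (f^~ x).
  by move=> /fs; exact: cvg_enumf.
have mR : measurable_fun E (fun x => rsum A (f^~ x)).
  by apply: measurable_fun_cvg cF => n; exact: mF.
pose s_ n x : \bar R := (series (u^~ x) n)%:E.
pose s x : \bar R := (rsum A (f^~ x))%:E.
have [|||||iR _ hcvg] := @dominated_convergence _ T R mu E mE s_ s (EFin \o g).
- by move=> n; apply/measurable_EFinP.
- exact/measurable_EFinP.
- by apply: aeW => x Ex; apply: cvg_EFin; [exact: nearW|exact: cF].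
- exact: ig.
- by apply: aeW => x n Ex; rewrite lee_fin; apply: norm_series_enumf_le; exact: fg.
split => //.
have iu j : mu.-integrable E (EFin \o u j).
  apply: (le_integrable mE _ _ ig); first exact/measurable_EFinP.
  move=> x Ex; rewrite /= lee_fin; apply: le_trans (ler_norm (g x)).
  have g0 : 0 <= g x.
    by rewrite -lee_fin (le_trans _ (fg x Ex))// esum_ge0.
  rewrite /u /enumf; case: pickle_inv => [i|]; last by rewrite normr0.
  case: ifPn => [|_]; last by rewrite normr0.
  by rewrite inE => Ai; exact: (norm_le_of_esum Ai (fg x Ex)).
have isum n : mu.-integrable E (EFin \o (fun x => series (u^~ x) n)) /\
    series (enumf A (fun i => \int[mu]_(x in E) f i x)) n =
    \int[mu]_(x in E) series (u^~ x) n.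
  elim: n => [|n [IH1 IH2]].
    have e : (fun x => series (u^~ x) 0) = cst 0.
      by apply/funext => x; rewrite seriesEnat/= big_geq.
    rewrite e; split; first exact: integrable0.
    by rewrite Rintegral_cst// mul0r seriesEnat/= big_geq.
  have e : (fun x => series (u^~ x) n.+1) = (fun x => series (u^~ x) n + u n x).
    by apply/funext => x; rewrite seriesSr.
  rewrite e; split; first exact: (integrableD mE IH1 (iu n)).
  rewrite RintegralD// -IH2 seriesSr; congr (_ + _).
  rewrite /u /enumf; case: pickle_inv => [i|]; last by rewrite Rintegral_cst// mul0r.
  by case: (i \in A) => //; rewrite Rintegral_cst// mul0r.
rewrite (_ : series _ = (fun n => \int[mu]_(x in E) series (u^~ x) n)); last first.
  by apply/funext => n; rewrite (isum n).2.
apply: fine_cvg; rewrite /Rintegral fineK; first exact: hcvg.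
exact: integrable_fin_num.
Qed.

End integration.
End real_sums.

(** * Integrals of cosines *)

Section averages.
Context {R : realType}.
Implicit Types (a b s d x : R).
Local Notation mu := (@lebesgue_measure R).

Lemma Rintegral_FTC (f F : R -> R) a b : a < b ->
    (forall x, a <= x <= b -> is_derive x 1 F (f x)) ->
    (forall x, a <= x <= b -> {for x, continuous f}) ->
  \int[mu]_(x in `[a, b]) f x = F b - F a.
Proof.
move=> ab dF cf; rewrite /Rintegral (@continuous_FTC2 _ f F)//.
- by apply: continuous_in_subspaceT => x; rewrite inE/= in_itv/=; exact: cf.
- have cF x : a <= x <= b -> {for x, continuous F}.
    by move=> /dF h; apply/differentiable_continuous/derivable1_diffP; apply: ex_derive.
  split.
  + move=> x; rewrite in_itv/= => /andP[h1 h2].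
    by have := dF x; rewrite !ltW// => /(_ isT) h; apply: ex_derive.
  + by apply: cvg_at_right_filter; apply: cF; rewrite lexx ltW.
  + by apply: cvg_at_left_filter; apply: cF; rewrite lexx ltW.
- move=> x; rewrite in_itv/= => /andP[h1 h2].
  by have := dF x; rewrite !ltW// => /(_ isT) h; rewrite derive1E; apply: derive_val.
Qed.

Lemma is_derive_affine s d x : is_derive x 1 (fun y : R => s + d * y) d.
Proof.
have h : is_derive x (1 : R) (cst s + d \*: id) (0 + d *: (1 : R)).
  by apply: is_deriveD; apply: is_deriveZ.
by apply: is_derive_eq h _; rewrite add0r /GRing.scale /= mulr1.
Qed.

Lemma is_derive_sin_affine s d x :
  is_derive x 1 (fun y : R => sin (s + d * y)) (d * cos (s + d * x)).
Proof.
have := @is_derive1_comp R sin (fun y => s + d * y) x _ _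
  (is_derive_sin (s + d * x)) (is_derive_affine s d x).
by rewrite mulrC.
Qed.

Lemma is_derive_cos_affine s d x :
  is_derive x 1 (fun y : R => cos (s + d * y)) (- (d * sin (s + d * x))).
Proof.
have := @is_derive1_comp R cos (fun y => s + d * y) x _ _
  (is_derive_cos (s + d * x)) (is_derive_affine s d x).
by rewrite mulNr mulrC.
Qed.

Lemma continuous_cos_affine s d : continuous (fun y : R => cos (s + d * y)).
Proof.
move=> x; apply/differentiable_continuous/derivable1_diffP.
by have h := is_derive_cos_affine s d x; apply: ex_derive.
Qed.

Lemma Rintegral_cos_affine a b s d : a < b -> d != 0 ->
  \int[mu]_(x in `[a, b]) cos (s + d * x) =
  (sin (s + d * b) - sin (s + d * a)) / d.
Proof.
move=> ab d0.
have dF x : is_derive x (1 : R) (fun y : R => sin (s + d * y) / d) (cos (s + d * x)).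
  have h : is_derive x (1 : R) (d^-1 \*: (fun y : R => sin (s + d * y)))
      (d^-1 *: (d * cos (s + d * x))).
    by apply: is_deriveZ; exact: is_derive_sin_affine.
  have -> : (fun y => sin (s + d * y) / d) = (d^-1 \*: (fun y : R => sin (s + d * y))).
    by apply/funext => y /=; rewrite mulrC.
  by apply: is_derive_eq h _; rewrite /GRing.scale /= mulrA mulVf// mul1r.
have -> := Rintegral_FTC ab (fun x _ => dF x) (fun x _ => @continuous_cos_affine s d x).
by rewrite mulrBl.
Qed.

Lemma sin_2pi_nat s n m :
  sin (s + (n%:R - m%:R) * (2 * pi)) = sin s.
Proof.
have h (k : nat) (t : R) : sin (t + k%:R * (2 * pi)) = sin t.
  have <- := periodicn (@sinD2pi R) k t; congr (sin (_ + _)).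
  by rewrite -(mulr_natl (pi *+ 2)) -(mulr_natl pi).
by rewrite -(h m) mulrBl addrA subrK h.
Qed.

(** The frequency is an integer, so the integral over a period is 0 unless the
    frequency is 0.  The phase s covers both cos (s = 0) and sin (s = - pi / 2). *)
Lemma average_cos s n m :
  \int[mu]_(x in `[0, 2 * pi]) cos (s + (n%:R - m%:R) * x) =
  if n == m then 2 * pi * cos s else 0.
Proof.
have pi0 : 0 < 2 * pi :> R by rewrite mulr_gt0// pi_gt0.
case: eqVneq => [->|nm].
  under eq_Rintegral do rewrite subrr mul0r addr0.
  rewrite Rintegral_cst//= lebesgue_measure_itv/= lte_fin pi0 -EFinB/= subr0.
  by rewrite mulrC.
rewrite Rintegral_cos_affine//; first by rewrite sin_2pi_nat mulr0 addr0 subrr mul0r.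
by rewrite subr_eq0 eqr_nat.
Qed.

End averages.

(** * Averaging over the centre *)

Definition equal_sums k : set (k.-tuple nat * k.-tuple nat) :=
  [set nm : k.-tuple nat * k.-tuple nat | (\sum_(n <- nm.1) n = \sum_(n <- nm.2) n)%N].

Definition same_mset k : set (k.-tuple nat * k.-tuple nat) :=
  [set nm : k.-tuple nat * k.-tuple nat | seq_mset nm.1 = seq_mset nm.2].

Arguments equal_sums : clear implicits.
Arguments same_mset : clear implicits.

Section phase_average.
Context {R : realType}.
Implicit Types (w phi s : R) (k : nat).
Local Notation mu := (@lebesgue_measure R).

Lemma series_enumfZ (I : countType) (A : set I) (c : R) (f : I -> R) n :
  series (enumf A (fun i => c * f i)) n = c * series (enumf A f) n.
Proof.
rewrite !seriesEnat /= mulr_sumr; apply: eq_bigr => j _; rewrite /enumf.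
by case: pickle_inv => [i|]; [case: ifP|]; rewrite ?mulr0.
Qed.

Lemma rsum_restrict (I : choiceType) (A B : set I) (f : I -> R) : abs_summable A f ->
  rsum A (fun i => if i \in B then f i else 0) = rsum (A `&` B) f.
Proof.
move=> fs; rewrite (rsum_split B); last first.
  by apply: abs_summable_le fs => i _; case: ifP => //; rewrite normr0.
rewrite [X in _ + X]rsum0 ?addr0; last by move=> i [_ Bi]; rewrite memNset.
by apply: eq_rsum => i [_ Bi]; rewrite mem_set.
Qed.

Section fixed_width.
Variables (k : nat) (w : R).
Hypotheses (k0 : (0 < k)%N) (w0 : 0 < w) (w2 : w < 2 * pi).

Lemma abs_summable_coef : abs_summable (D_index k) (@coef R w k).
Proof.
have [C _ /(_ w w0 w2) h] := @esum_coef_le R k k0.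
by rewrite /abs_summable (le_lt_trans h)// ltry.
Qed.

Lemma csummable_D_term phi : csummable (D_index k) (D_term w k phi).
Proof.
split; apply: (abs_summable_le _ abs_summable_coef) => nm _.
- by rewrite Re_D_term normrM ler_piMr// cos_max.
- by rewrite Im_D_term normrM ler_piMr// sin_max.
Qed.

(** Integration over the centre keeps exactly the terms of frequency 0, that is
    those whose two tuples have equal sums. *)
Lemma average_rsum s :
  mu.-integrable `[0, 2 * pi]
    (fun phi => (rsum (D_index k) (fun nm => coef w nm * cos (s + frequency nm * phi)))%:E) /\
  \int[mu]_(phi in `[0, 2 * pi])
     rsum (D_index k) (fun nm => coef w nm * cos (s + frequency nm * phi)) =
  2 * pi * cos s * rsum (D_index k `&` equal_sums k) (@coef R w k).
Proof.
have [C _ /(_ w w0 w2) h] := @esum_coef_le R k k0.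
have [||||iD hcvg] := @integral_rsum R _ _ _ mu (D_index k) `[0, 2 * pi]%classic
  (fun nm phi => coef w nm * cos (s + frequency nm * phi)) (cst (C / Num.sqrt w)).
- exact: measurable_itv.
- move=> nm _; apply: measurable_funTS; apply: measurable_funM => //.
  by apply: continuous_measurable_fun => x; exact: continuous_cos_affine.
- apply/integrableP; split; first exact/measurable_EFinP.
  rewrite (eq_integral (cst `|C / Num.sqrt w|%:E))//.
  rewrite integral_cst//= lebesgue_measure_itv/=; case: ifP => _; last by rewrite mule0 ltry.
  by rewrite -EFinB -EFinM ltry.
- move=> phi _; apply: le_trans h; apply: le_esum => nm _.
  by rewrite lee_fin normrM ler_piMr// cos_max.
split => //; apply: (cvg_unique _ hcvg) => //.
have fE : (fun nm : k.-tuple nat * k.-tuple nat =>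
     \int[mu]_(x in `[0, 2 * pi]) (coef w nm * cos (s + frequency nm * x))) =
   (fun nm => 2 * pi * cos s * (if nm \in equal_sums k then coef w nm else 0)).
  apply/funext => nm; rewrite RintegralZl//=; last first.
    apply: continuous_compact_integrable; first exact: segment_compact.
    by apply: continuous_subspaceT => x; exact: continuous_cos_affine.
  rewrite /frequency average_cos.
  case: eqVneq => [e|/eqP e]; first by rewrite mem_set// mulrC.
  by rewrite memNset// !mulr0.
have es : abs_summable (D_index k) (fun nm => if nm \in equal_sums k then coef w nm else 0).
  apply: abs_summable_le abs_summable_coef => nm _.
  by case: ifP => //; rewrite normr0.
rewrite fE -rsum_restrict//; last exact: abs_summable_coef.
rewrite (_ : series _ = (fun n => 2 * pi * cos s * series (enumf (D_index k)
    (fun nm => if nm \in equal_sums k then coef w nm else 0)) n)); last first.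
  by apply/funext => n; rewrite series_enumfZ.
by apply: cvgMl_tmp; exact: cvg_enumf.
Qed.

Lemma D2kE phi : D2k w k phi =
  rsum (D_index k) (fun nm => coef w nm * cos (0 + frequency nm * phi)) +i*
  rsum (D_index k) (fun nm => coef w nm * cos (- (pi / 2) + frequency nm * phi)).
Proof.
rewrite /D2k /csum; congr (_ +i* _); apply: eq_rsum => nm _.
  by rewrite Re_D_term add0r.
by rewrite Im_D_term addrC cosBpihalf.
Qed.

Lemma cintegrable_D2k : cintegrable mu `[0, 2 * pi] (D2k w k).
Proof.
split.
- by apply: eq_integrable (average_rsum 0).1 => // phi _; rewrite D2kE.
- by apply: eq_integrable (average_rsum (- (pi / 2))).1 => // phi _; rewrite D2kE.
Qed.

Lemma cintegral_D2k : cintegral mu `[0, 2 * pi] (D2k w k) =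
  (2 * pi * rsum (D_index k `&` equal_sums k) (@coef R w k))%:C.
Proof.
rewrite /cintegral; congr (_ +i* _).
  transitivity (2 * pi * cos 0 * rsum (D_index k `&` equal_sums k) (@coef R w k)).
    by rewrite -(average_rsum 0).2; apply: eq_Rintegral => phi _; rewrite D2kE.
  by rewrite cos0 mulr1.
transitivity (2 * pi * cos (- (pi / 2)) *
  rsum (D_index k `&` equal_sums k) (@coef R w k)).
  by rewrite -(average_rsum _).2; apply: eq_Rintegral => phi _; rewrite D2kE.
by rewrite cosN cos_pihalf mulr0 mul0r.
Qed.

Lemma D2k_WickE phi : D2k_Wick w k phi =
  (rsum (D_index k `&` same_mset k) (@coef R w k))%:C.
Proof.
have f0 (nm : k.-tuple nat * k.-tuple nat) :
    (D_index k `&` same_mset k) nm -> frequency nm = 0 :> R.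
  case=> _ /= /eq_seq_msetP h; rewrite /frequency (perm_big _ h)/=.
  by rewrite subrr.
rewrite /D2k_Wick /csum; congr (_ +i* _).
  by apply: eq_rsum => nm /f0 h; rewrite Re_D_term h mul0r cos0 mulr1.
by apply: rsum0 => nm /f0 h; rewrite Im_D_term h mul0r sin0 mulr0.
Qed.

Lemma average_D2k phi :
  ((2 * pi)^-1)%:C * cintegral mu `[0, 2 * pi] (D2k w k) =
  D2k_Wick w k phi +
  (rsum (D_index k `&` equal_sums k `&` ~` same_mset k) (@coef R w k))%:C.
Proof.
have pi0 : 2 * pi != 0 :> R by rewrite mulf_neq0// gt_eqF// pi_gt0.
rewrite cintegral_D2k -rmorphM/= mulrA mulVf// mul1r D2k_WickE -rmorphD/=.
congr (_%:C); rewrite (rsum_split (same_mset k)); last first.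
  by apply: abs_summable_sub abs_summable_coef; exact: subIsetl.
congr (rsum _ _ + _); apply/seteqP; split => nm [].
  by case=> ? ? ?.
move=> Dnm h; split => //; split => //.
by move/eq_seq_msetP : h => /= h; rewrite /equal_sums /= (perm_big _ h).
Qed.

End fixed_width.
End phase_average.

(** * Grouping by multisets *)

(** The division in [mult] is exact by the multinomial formula. *)
Lemma mset_size_permutations (M : {mset nat}) : size (permutations M) = mult M.
Proof.
rewrite /mult -(@size_permutations_prod_fact _ M (finsupp M)) ?fset_uniq//; last first.
  by move=> v; rewrite msuppE.
under eq_bigr do rewrite count_mem_mset.
by rewrite mulnK// prodn_gt0// => i; exact: fact_gt0.
Qed.

(** Ordered pairs: each unordered pair of the target formula occurs twice here,
    which accounts for its factor 2. *)
Definition mset_pairs k : set ({mset nat} * {mset nat}) :=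
  [set p | exists P S, [/\ Mset k P S p.1, Mset k P S p.2 & p.1 <> p.2]].

Arguments mset_pairs : clear implicits.

Definition mset_pair k (nm : k.-tuple nat * k.-tuple nat) : {mset nat} * {mset nat} :=
  (seq_mset nm.1, seq_mset nm.2).

Definition offdiag k : set (k.-tuple nat * k.-tuple nat) :=
  D_index k `&` equal_sums k `&` ~` same_mset k.

Arguments offdiag : clear implicits.

Section packets.
Context {R : realType}.
Implicit Types (w : R) (k P S : nat) (M : {mset nat}).

Lemma Rprod_seq_mset w (s : seq nat) :
  \prod_(n <- s) rhat w n = Rprod w (seq_mset s).
Proof. by rewrite /Rprod -(perm_big _ (perm_eq_seq_mset s)) big_mset. Qed.

Lemma rsum_finite (I : choiceType) (A : set I) (f : I -> R) : finite_set A ->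
  rsum A f = \sum_(i <- fset_set A) f i.
Proof.
move=> Afin; rewrite rsumE !esum_fset//; last 2 first.
- by move=> i _; rewrite lee_fin le_max lexx orbT.
- by move=> i _; rewrite lee_fin le_max lexx orbT.
rewrite !fsbig_finite//= !sumEFin /= -sumrB; apply: eq_bigr => i _.
exact: posBneg.
Qed.

Lemma rsum_seq (I : choiceType) (A : set I) (s : seq I) (f : I -> R) : uniq s ->
  (forall i, A i <-> i \in s) -> rsum A f = \sum_(i <- s) f i.
Proof.
move=> s_uniq As; have Afin : finite_set A.
  apply: (@sub_finite_set _ _ [set` s]); last exact: finite_seq.
  by move=> i /As.
rewrite rsum_finite//; apply: perm_big; apply: uniq_perm => //.
move=> i; rewrite in_fset_set//; apply/idP/idP; first by rewrite inE => /As.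
by move=> /As Ai; rewrite mem_set.
Qed.

Definition tuples_of_mset k M : seq (k.-tuple nat) := pmap insub (permutations M).

Lemma tuples_of_mset_uniq k M : uniq (tuples_of_mset k M).
Proof. by apply: pmap_sub_uniq; exact: permutations_uniq. Qed.

Lemma mem_tuples_of_mset k M (t : k.-tuple nat) :
  (t \in tuples_of_mset k M) = (seq_mset t == M).
Proof.
rewrite mem_pmap_sub mem_permutations; apply/idP/eqP => [h|<-].
  by rewrite -[M]seq_mset_id; apply/eq_seq_msetP.
by rewrite perm_sym perm_eq_seq_mset.
Qed.

Lemma size_tuples_of_mset k M : size M = k -> size (tuples_of_mset k M) = mult M.
Proof.
move=> sM; rewrite size_pmap_sub -mset_size_permutations; apply/eqP.
rewrite -all_count; apply/allP => s; rewrite mem_permutations => /perm_size.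
by rewrite sM => /eqP.
Qed.

(** The entries of a multiset of positive integers with product P are at most P. *)
Lemma finite_Mset k P S : finite_set (Mset k P S).
Proof.
apply: (@sub_finite_set _ _
  ((fun f : {ffun 'I_k -> 'I_P.+1} => seq_mset [seq val (f i) | i <- enum 'I_k]) @` setT)).
  move=> M [sM Mpos MP _].
  have hle v : v \in M -> (v < P.+1)%N.
    move=> vM; rewrite ltnS dvdn_leq//.
      by rewrite -MP big_seq prodn_cond_gt0.
    by rewrite -MP (big_rem v)//= dvdn_mulr.
  pose t := in_tuple M.
  have sM' : size (M : seq nat) == k by apply/eqP.
  pose u : k.-tuple nat := Tuple sM'.
  have hu i : (tnth u i < P.+1)%N by apply: hle; exact: mem_tnth.
  exists [ffun i => Ordinal (hu i)] => //.
  rewrite -[RHS]seq_mset_id; congr seq_mset.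
  rewrite -[RHS](map_tnth_enum u); apply: eq_map => i.
  by rewrite ffunE.
exact: finite_image.
Qed.

Definition mweight w M : R := (mult M)%:R * Rprod w M.

Definition packet w (p : {mset nat} * {mset nat}) : R :=
  mweight w p.1 * mweight w p.2 / (\prod_(v <- p.1) v)%N%:R.

Lemma prod_seq_mset (s : seq nat) : (\prod_(v <- seq_mset s) v = \prod_(v <- s) v)%N.
Proof. exact: perm_big (perm_eq_seq_mset s). Qed.

Lemma sum_seq_mset (s : seq nat) : (\sum_(v <- seq_mset s) v = \sum_(v <- s) v)%N.
Proof. exact: perm_big (perm_eq_seq_mset s). Qed.

Lemma seq_mset_Mset k (t : k.-tuple nat) : all (leq 1) t ->
  Mset k (\prod_(v <- t) v)%N (\sum_(v <- t) v)%N (seq_mset t).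
Proof.
move=> /allP tpos; split.
- by rewrite (perm_size (perm_eq_seq_mset t)) size_tuple.
- by move=> v; rewrite (perm_mem (perm_eq_seq_mset t)) => /tpos.
- exact: prod_seq_mset.
- exact: sum_seq_mset.
Qed.

Lemma offdiag_mset_pairs k nm : offdiag k nm -> mset_pairs k (mset_pair nm).
Proof.
move=> [[[n1 m1 nm_prod] nm_sum] nm_neq].
exists (\prod_(v <- nm.1) v)%N, (\sum_(v <- nm.1) v)%N; split => //.
  exact: seq_mset_Mset.
by rewrite nm_prod nm_sum; exact: seq_mset_Mset.
Qed.

(** [coef] depends only on the two underlying multisets, and a multiset of size k
    is the multiset of exactly [mult] k-tuples. *)
Lemma packet_rsum k w p : mset_pairs k p ->
  packet w p = rsum (offdiag k `&` [set nm | mset_pair nm = p]) (@coef R w k).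
Proof.
case: p => M M' [P [S /= [hM hM' MM']]].
rewrite (@rsum_seq _ _ (allpairs pair (tuples_of_mset k M) (tuples_of_mset k M'))).
- rewrite big_allpairs.
  transitivity (\sum_(t <- tuples_of_mset k M) \sum_(t' <- tuples_of_mset k M')
     (Rprod w M * Rprod w M' / (\prod_(v <- M) v)%N%:R)).
    rewrite !big_const_seq !count_predT !iter_addr_0 !size_tuples_of_mset; last 2 first.
    - by case: hM.
    - by case: hM'.
    by rewrite /packet /mweight/= -[RHS]mulr_natr -(mulr_natr (_ / _) (mult M')); ring.
  rewrite big_seq [RHS]big_seq; apply: eq_bigr => t; rewrite mem_tuples_of_mset => /eqP tM.
  rewrite big_seq [RHS]big_seq; apply: eq_bigr => t'; rewrite mem_tuples_of_mset => /eqP tM'.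
  by rewrite /coef/= !Rprod_seq_mset tM tM' -tM prod_seq_mset.
- by apply: allpairs_uniq; [exact: tuples_of_mset_uniq|exact: tuples_of_mset_uniq|move=> [? ?] [? ?]].
- move=> [t t']; split.
    by case=> _ [tM tM']; apply: allpairs_f; rewrite mem_tuples_of_mset; apply/eqP.
  case/allpairsP => -[u u'] /= [+ + [-> ->]].
  rewrite !mem_tuples_of_mset => /eqP uM /eqP uM'; split; last by rewrite /= /mset_pair/= uM uM'.
  case: hM => _ M0 MP MS; case: hM' => _ M0' MP' MS'.
  split; last by rewrite /same_mset/= uM uM'.
  split.
    split => /=.
    + by apply/allP => v vu; apply: M0; rewrite -uM (perm_mem (perm_eq_seq_mset u)).
    + by apply/allP => v vu; apply: M0'; rewrite -uM' (perm_mem (perm_eq_seq_mset u')).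
    + by rewrite -(prod_seq_mset u) -(prod_seq_mset u') uM uM' MP MP'.
  by rewrite /equal_sums/= -(sum_seq_mset u) -(sum_seq_mset u') uM uM' MS MS'.
Qed.

Lemma sum_fset_mem (I : choiceType) (A X : {fset I}) (F : I -> R) :
  (A `<=` X)%fset -> \sum_(x <- X) (if x \in A then F x else 0) = \sum_(x <- A) F x.
Proof.
move=> AX; rewrite -big_mkcond -big_filter; apply: perm_big; apply: uniq_perm.
- exact/filter_uniq/fset_uniq.
- exact: fset_uniq.
by move=> x; rewrite mem_filter; case: (boolP (x \in A)) => //= /(fsubsetP AX).
Qed.

(** Every two-element set {x, y} comes from the two ordered pairs (x, y), (y, x). *)
Lemma sum_offdiag_pairs (I : choiceType) (X : {fset I}) (a : I -> R) :
  \sum_(x <- X) \sum_(y <- X) (if x != y then a x * a y else 0) =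
  2 * \sum_(A <- fpowerset X | #|` A| == 2%N) \prod_(x <- A) a x.
Proof.
(* summed over A, H x y gives back the term of the pair (x, y), as A must be {x, y} *)
pose H (x y : I) (A : {fset I}) : R :=
  if [&& x != y, #|` A| == 2%N, x \in A & y \in A] then a x * a y else 0.
transitivity (\sum_(x <- X) \sum_(y <- X) \sum_(A <- fpowerset X) H x y A).
  rewrite big_seq [RHS]big_seq; apply: eq_bigr => x xX.
  rewrite big_seq [RHS]big_seq; apply: eq_bigr => y yX.
  case: ifPn => [xy|/negbTE xy]; last by rewrite big1// => A _; rewrite /H xy.
  have sub (A : {fset I}) : x \in A -> y \in A -> ([fset x; y] `<=` A)%fset.
    by move=> xA yA; apply/fsubsetP => z; rewrite !inE => /orP[] /eqP ->.
  rewrite (bigD1_seq [fset x; y]%fset) ?fset_uniq//=; last by rewrite fpowersetE sub.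
  rewrite /H xy cardfs2 xy !inE !eqxx orbT /= big1 ?addr0// => A Axy.
  case: ifPn => // /and3P[/eqP A2 xA yA].
  case/eqP: Axy; apply/esym/eqP; rewrite eqEfcard sub// A2 cardfs2 xy.
  by [].
under eq_bigr do rewrite exchange_big.
rewrite exchange_big mulr_sumr [RHS]big_mkcond /=.
rewrite big_seq [RHS]big_seq; apply: eq_bigr => A; rewrite fpowersetE => AX.
case: ifPn => [A2|/negbTE A2]; last first.
  by rewrite big1// => x _; rewrite big1// => y _; rewrite /H A2 andbF.
transitivity (\sum_(x <- A) \sum_(y <- A) (if x != y then a x * a y else 0)).
  rewrite -(sum_fset_mem _ AX); apply: eq_bigr => x _; case: ifPn => [xA|/negbTE xA].
    rewrite -(sum_fset_mem _ AX); apply: eq_bigr => y _.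
    by rewrite /H A2 xA /=; case: (y \in A); rewrite ?andbF ?andbT.
  by rewrite big1// => y _; rewrite /H xA /= !andbF.
have /fset0Pn[u uA] : A != fset0 by rewrite -cardfs_gt0 (eqP A2).
have /cardfs1P[v Av] : #|` (A `\ u)%fset| == 1%N.
  by move: A2; rewrite (cardfsD1 u) uA.
have uv : u != v.
  have : v \in (A `\ u)%fset by rewrite Av inE.
  by rewrite in_fsetD1 eq_sym => /andP[].
rewrite -(fsetD1K uA) Av.
have uv' : u \notin [fset v]%fset by rewrite inE.
rewrite !big_fsetU1//= !big_seq_fset1 !big_fsetU1//= !big_seq_fset1 !eqxx.
rewrite [v == u]eq_sym (negbTE uv) /=.
ring.
Qed.

Lemma VO_termE k w (PS : nat * nat) : VO_term w k PS =
  rsum (mset_pairs k `&` [set p : {mset nat} * {mset nat} |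
    (\prod_(v <- p.1) v, \sum_(v <- p.1) v)%N = PS]) (packet w).
Proof.
case: PS => P S; set X := Mfset k P S.
have XE M : (M \in X) <-> Mset k P S M.
  by rewrite /X /Mfset in_fset_set ?inE//; exact: finite_Mset.
rewrite (@rsum_seq _ _ [seq p <- allpairs pair X X | p.1 != p.2]); last 2 first.
- apply: filter_uniq; apply: allpairs_uniq; rewrite ?fset_uniq//.
  by move=> [? ?] [? ?].
- move=> [M M']; rewrite mem_filter; split.
    case=> [[P' [S' /= [hM hM' MM']]]] [eP eS].
    apply/andP; split; first exact/eqP.
    case: (hM) => _ _ eP' eS'; move: hM hM'; rewrite -eP' -eS' eP eS => hM hM'.
    by apply: allpairs_f; apply/XE.
  case/andP => /= /eqP MM' /allpairsP[[N N'] /= [/XE hN /XE hN' [eN eN']]].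
  rewrite -{}eN -{}eN' in hN hN'.
  split; first by exists P, S.
  by case: hN => _ _ -> ->.
rewrite big_filter big_mkcond big_allpairs/= /VO_term -/X.
transitivity (P%:R^-1 * \sum_(x <- X) \sum_(y <- X) (if x != y then mweight w x * mweight w y else 0)).
  by rewrite sum_offdiag_pairs /mweight/=; ring.
rewrite mulr_sumr big_seq [RHS]big_seq; apply: eq_bigr => M /XE[_ _ MP _].
rewrite mulr_sumr; apply: eq_bigr => M' _; case: ifP => _; last by rewrite mulr0.
by rewrite /packet/= MP mulrC.
Qed.

Lemma VO_indexP k P S M M' : Mset k P S M -> Mset k P S M' -> M <> M' ->
  VO_index k (P, S).
Proof.
move=> hM hM' MM'; rewrite /VO_index/=.
have XE N : Mset k P S N -> N \in Mfset k P S.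
  by move=> hN; rewrite /Mfset in_fset_set ?inE//; exact: finite_Mset.
apply: (@leq_trans #|` [fset M; M']%fset|).
  by rewrite cardfs2; case: eqP.
apply: fsubset_leq_card; apply/fsubsetP => N; rewrite in_fset2.
by case/predU1P => [->|/eqP ->]; [exact: XE hM|exact: XE hM'].
Qed.

(** Two successive groupings: pairs of tuples by their pair of multisets, then
    pairs of multisets by their common product and sum. *)
Lemma rsum_offdiag k w : abs_summable (D_index k) (@coef R w k) ->
  abs_summable (VO_index k) (VO_term w k) /\
  rsum (offdiag k) (@coef R w k) = VO2k w k.
Proof.
move=> cs; have cs' : abs_summable (offdiag k) (@coef R w k).
  by apply: abs_summable_sub cs => nm [[]].
have [ps ->] := rsum_fibers cs' (@offdiag_mset_pairs k) (@packet_rsum k w).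
apply: (rsum_fibers (q := fun p : {mset nat} * {mset nat} =>
  (\prod_(v <- p.1) v, \sum_(v <- p.1) v)%N) ps) => [[M M']|PS _].
  move=> [P [S /= [hM hM' MM']]].
  by case: (hM) => _ _ -> ->; exact: VO_indexP hM hM' MM'.
exact: VO_termE.
Qed.

End packets.

(** * Integrability of the inverse square root *)

Section inverse_sqrt.
Context {R : realType}.
Local Notation mu := (@lebesgue_measure R).

Lemma measurable_invsqrt (E : set R) : measurable E -> E `<=` `]0, +oo[ ->
  measurable_fun E (fun w : R => (Num.sqrt w)^-1).
Proof.
move=> mE E0; apply: (eq_measurable_fun (fun w : R => w `^ (- 2^-1))).
  move=> w; rewrite inE => /E0; rewrite /= in_itv/= andbT => w0.
  by rewrite powRN powR12_sqrt// ltW.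
by apply: measurable_funTS; exact: measurable_powR.
Qed.

Lemma integral_invsqrt_le (d T : R) : 0 < d -> 
  (\int[mu]_(w in `[d, T]) ((Num.sqrt w)^-1)%:E <= (2 * Num.sqrt T)%:E)%E.
Proof.
move=> d0; have [dT|Td] := ltP d T; last first.
  move: Td; rewrite le_eqVlt => /predU1P[->|Td].
    rewrite set_itv1 integral_set1 lee_fin mulr_ge0// sqrtr_ge0.
  rewrite set_itv_ge; last by rewrite bnd_simp -ltNge.
  by rewrite integral_set0 lee_fin mulr_ge0// sqrtr_ge0.
have dF w : d <= w <= T -> is_derive w (1 : R) (2 \*: Num.sqrt) (Num.sqrt w)^-1.
  move=> /andP[dw _]; have w0 : 0 < w by exact: lt_le_trans dw.
  have h := is_derive1_sqrt w0.
  have h2 : is_derive w (1 : R) (2 \*: Num.sqrt) (2 *: (2 * Num.sqrt w)^-1).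
    exact: is_deriveZ.
  apply: is_derive_eq h2 _; rewrite /GRing.scale /= invfM mulrA mulfV ?mul1r//.
have cf w : d <= w <= T -> {for w, continuous (fun w : R => (Num.sqrt w)^-1)}.
  move=> /andP[dw _]; have w0 : 0 < w by exact: lt_le_trans dw.
  apply: cvgV; first by rewrite gt_eqF// sqrtr_gt0.
  exact: sqrt_continuous.
have e := Rintegral_FTC dT dF cf.
have mf : measurable_fun `[d, T] (fun w : R => (Num.sqrt w)^-1).
  apply: measurable_invsqrt => // w; rewrite /= !in_itv/= andbT => /andP[dw _].
  exact: lt_le_trans dw.
rewrite -[leLHS]fineK; last first.
  apply: integrable_fin_num => //.
  apply: continuous_compact_integrable; first exact: segment_compact.
  by apply: continuous_in_subspaceT => w; rewrite inE/= in_itv/=; exact: cf.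
rewrite lee_fin -/(Rintegral _ _ _) e /= /GRing.scale/=.
by rewrite lerBlDr lerDl mulr_ge0// sqrtr_ge0.
Qed.

(** The primitive 2 sqrt w bounds the integrals over [1 / (n + 1), T], which
    increase to the integral over ]0, T]. *)
Lemma integrable_invsqrt (C T : R) :
  mu.-integrable `]0, T] (EFin \o (fun w : R => C / Num.sqrt w)).
Proof.
have m0 : measurable_fun `]0, T] (fun w : R => (Num.sqrt w)^-1).
  by apply: measurable_invsqrt => // w; rewrite /= !in_itv/= => /andP[-> _].
apply: (@integrableZl _ _ _ mu `]0, T]%classic _ C (EFin \o (fun w : R => (Num.sqrt w)^-1))) => //.
apply/integrableP; split; first exact/measurable_EFinP.
apply: (@le_lt_trans _ _ (2 * Num.sqrt T)%:E); last exact: ltry.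
under eq_integral.
  move=> w; rewrite inE /= in_itv /= => /andP[w0 _].
  rewrite ger0_norm ?invr_ge0 ?sqrtr_ge0//. over.
pose F (n : nat) : set R := `[n.+1%:R^-1, T]%classic.
have -> : `]0, T]%classic = \bigcup_n F n.
  apply/seteqP; split => w.
    rewrite /= in_itv/= => /andP[w0 wT].
    exists (Num.truncn w^-1) => //; rewrite /F/= in_itv/= wT andbT.
    have wV0 : 0 <= w^-1 by rewrite invr_ge0 ltW.
    have /andP[_ /ltW h] := truncn_itv wV0.
    by rewrite -[leRHS]invrK lef_pV2 ?posrE ?invr_gt0.
  move=> [n _]; rewrite /F /= !in_itv/= => /andP[nw ->]; rewrite andbT.
  by rewrite (lt_le_trans _ nw)// invr_gt0.
have Fpos n : F n `<=` `]0, +oo[%classic.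
  move=> w; rewrite /F /= !in_itv/= andbT => /andP[nw _].
  by rewrite (lt_le_trans _ nw)// invr_gt0.
have hc := @ge0_nondecreasing_set_cvg_integral _ (measurableTypeR R) R F
  (fun w => ((Num.sqrt w)^-1)%:E) mu.
apply: (cvge_to_le (hc _ _ _ _)).
- move=> n m nm; apply/subsetPset => w; rewrite /F /= !in_itv/= => /andP[nw ->].
  rewrite andbT (le_trans _ nw)// lef_pV2 ?posrE// ler_nat//.
- by move=> n; exact: measurable_itv.
- by move=> n; apply/measurable_EFinP; apply: measurable_invsqrt => //; exact: measurable_itv.
- by move=> n w _; rewrite lee_fin invr_ge0 sqrtr_ge0.
- by apply: nearW => n; apply: integral_invsqrt_le; rewrite invr_gt0.
Qed.

End inverse_sqrt.

(** * Positive definite functions of the width *)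

Section positive_definite.
Context {R : realType}.
Local Notation mu := (@lebesgue_measure R).
Variable T : R.
Hypothesis T0 : 0 < T.

Lemma integrable_bounded_itv (f : R -> R) (c : R) :
  measurable_fun setT f -> (forall w : R, 0 < w <= T -> `|f w| <= c) ->
  mu.-integrable `]0, T] (EFin \o f).
Proof.
move=> mf fc; apply: measurable_bounded_integrable => //.
- by rewrite /= lebesgue_measure_itv/= lte_fin T0 -EFinB ltry.
- exact: measurable_funTS.
exists c; split; first exact: num_real.
move=> y cy w; rewrite /= in_itv/= => wT; rewrite (le_trans (fc w wT))// ltW//.
Qed.

Definition triangle (w : R) : R := 1 - w / T.

Lemma measurable_triangle : measurable_fun setT triangle.
Proof.
apply: measurable_funB => //; exact: measurable_funM.
Qed.

Lemma triangle_bounds w : 0 < w <= T -> 0 <= triangle w <= 1.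
Proof.
move=> /andP[w0 wT]; rewrite /triangle subr_ge0 ler_pdivrMr// mul1r wT/=.
by rewrite lerBlDr lerDl divr_ge0// ltW.
Qed.

(** The triangle function is positive definite: for z != 0 the integral
    equals (1 - cos (z T)) / (T z ^ 2). *)
Lemma integral_triangle_cos_ge0 z : 0 <= \int[mu]_(w in `]0, T]) (triangle w * cos (0 + z * w)).
Proof.
have [->|z0] := eqVneq z 0.
  apply: Rintegral_ge0 => w; rewrite /= in_itv/= => /triangle_bounds/andP[h _].
  by rewrite mul0r addr0 cos0 mulr1.
rewrite Rintegral_itv_obnd_cbnd; last first.
  apply: (@integrable_bounded_itv (fun w => triangle w * cos (0 + z * w)) 1).
    apply: measurable_funM; first exact: measurable_triangle.
    by apply: continuous_measurable_fun => w; exact: continuous_cos_affine.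
  move=> w /triangle_bounds/andP[h1 h2]; rewrite normrM mulr_ile1 ?cos_max//.
  by rewrite ger0_norm.
pose A w : R := 1 + (- T^-1) * w.
pose S w := sin (0 + z * w).
pose C w := cos (0 + z * w).
have T1 : T != 0 by rewrite gt_eqF.
have dF w : is_derive w (1 : R) (z^-1 \*: (A * S) - (T * z ^+ 2)^-1 \*: C)
    (triangle w * cos (0 + z * w)).
  have dA : is_derive w (1 : R) A (- T^-1) := is_derive_affine _ _ _.
  have dS : is_derive w (1 : R) S _ := is_derive_sin_affine _ _ _.
  have dC : is_derive w (1 : R) C _ := is_derive_cos_affine _ _ _.
  have h := is_deriveB (is_deriveZ z^-1 (is_deriveM dA dS))
                       (is_deriveZ (T * z ^+ 2)^-1 dC).
  apply: is_derive_eq h _; rewrite /GRing.scale /= /triangle /A /S.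
  set s := sin _; set c := cos _; field.
  by rewrite T1 z0.
have cf w : {for w, continuous (fun w : R => triangle w * cos (0 + z * w))}.
  apply: cvgM; last exact: continuous_cos_affine.
  by apply: cvgB; [exact: cvg_cst|apply: cvgMr_tmp; exact: cvg_id].
rewrite (Rintegral_FTC T0 (fun w _ => dF w) (fun w _ => cf w)).
rewrite !fctE /= /GRing.scale /= [X in 0 <= X](_ : _ = (1 - C T) / (T * z ^+ 2)).
  by rewrite divr_ge0 ?subr_ge0 ?cos_le1// mulr_ge0 ?sqr_ge0// ltW.
have AT : A T = 0 by rewrite /A mulNr mulVf// subrr.
have S0 : S 0 = 0 by rewrite /S mulr0 addr0 sin0.
have C0 : C 0 = 1 by rewrite /C mulr0 addr0 cos0.
by rewrite AT S0 C0; ring.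
Qed.

(** Positivity of the cosine transform after multiplication by the triangle
    function; the bounds make this class closed under pointwise limits. *)
Definition posdef (f : R -> R) : Prop :=
  [/\ measurable_fun setT f, forall w : R, `|f w| <= 1 &
      forall z : R, 0 <= \int[mu]_(w in `]0, T]) (triangle w * (f w * cos (0 + z * w)))].

Lemma integrable_posdef (f : R -> R) (z : R) : measurable_fun setT f -> (forall w : R, `|f w| <= 1) ->
  mu.-integrable `]0, T] (EFin \o (fun w => triangle w * (f w * cos (0 + z * w)))).
Proof.
move=> mf f1; apply: (@integrable_bounded_itv _ 1).
  apply: measurable_funM; first exact: measurable_triangle.
  apply: measurable_funM => //.
  by apply: continuous_measurable_fun => w; exact: continuous_cos_affine.
move=> w /triangle_bounds/andP[h1 h2]; rewrite normrM mulr_ile1//.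
  by rewrite ger0_norm.
by rewrite normrM mulr_ile1// cos_max.
Qed.

Lemma posdef1 : posdef (cst 1).
Proof.
split=> [|w|z]; [by []|by rewrite normr1|].
by under eq_Rintegral do rewrite mul1r; exact: integral_triangle_cos_ge0.
Qed.

(** A product of two cosines is the mean of the cosines of the sum and of the
    difference. *)
Lemma posdefM_cos (f : R -> R) (a : R) : posdef f -> posdef (fun w => f w * cos (0 + a * w)).
Proof.
move=> [mf f1 fpos].
have mc : measurable_fun setT (fun w : R => cos (0 + a * w)).
  by apply: continuous_measurable_fun => w; exact: continuous_cos_affine.
split=> [|w|z].
- exact: measurable_funM.
- by rewrite normrM mulr_ile1// cos_max.
have -> : \int[mu]_(w in `]0, T]) (triangle w * (f w * cos (0 + a * w) * cos (0 + z * w))) =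
    2^-1 * (\int[mu]_(w in `]0, T]) (triangle w * (f w * cos (0 + (z + a) * w))) +
            \int[mu]_(w in `]0, T]) (triangle w * (f w * cos (0 + (z - a) * w)))).
  have mI : measurable (`]0, T]%classic : set (measurableTypeR R)) by [].
  have I1 := integrable_posdef (z + a) mf f1.
  have I2 := integrable_posdef (z - a) mf f1.
  rewrite -RintegralD// -RintegralZl//=; last exact: (integrableD mI I1 I2).
  apply: eq_Rintegral => w _.
  have -> : 0 + (z + a) * w = (0 + z * w) + (0 + a * w) by ring.
  have -> : 0 + (z - a) * w = (0 + z * w) - (0 + a * w) by ring.
  move: (0 + z * w) (0 + a * w) => u v.
  by rewrite cosD cosB; field.
by rewrite mulr_ge0// addr_ge0.
Qed.

Lemma posdef_lim (f_ : nat -> R -> R) (f : R -> R) : (forall n, posdef (f_ n)) ->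
  (forall w, f_ ^~ w @ \oo --> f w) -> posdef f.
Proof.
move=> pf fl.
have mf : measurable_fun setT f.
  by apply: (@measurable_fun_cvg _ _ _ setT f_ f) => [n|w _]; [have [] := pf n|exact: fl].
have f1 w : `|f w| <= 1.
  have h : (fun n => `|f_ n w| : R) @ \oo --> (`|f w| : R) by exact: cvg_norm (fl w).
  by apply: (cvgr_to_le h); apply: nearW => n; have [] := pf n.
split => // z.
have i1 := integrable_posdef z mf f1.
have ig : mu.-integrable `]0, T] (EFin \o (cst 1 : R -> R)).
  by apply: (@integrable_bounded_itv _ 1) => // w _; rewrite normr1.
pose h_ n w : \bar R := (triangle w * (f_ n w * cos (0 + z * w)))%:E.
pose h w : \bar R := (triangle w * (f w * cos (0 + z * w)))%:E.
have mI : measurable (`]0, T]%classic : set (measurableTypeR R)) by [].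
have [|||||_ _ hcvg] := @dominated_convergence _ (measurableTypeR R) R mu `]0, T]%classic mI h_ h
  (EFin \o (cst 1 : R -> R)).
- move=> n; have [mfn fn1 _] := pf n.
  by have /integrableP[] := integrable_posdef z mfn fn1.
- by have /integrableP[] := i1.
- apply: aeW => w _; apply: cvg_EFin; first exact: nearW.
  have hc : (fun n => triangle w * (f_ n w * cos (0 + z * w))) @ \oo -->
      triangle w * (f w * cos (0 + z * w)).
    by apply: cvgMl_tmp; apply: cvgMr_tmp; exact: fl.
  exact: hc.
- exact: ig.
- apply: aeW => w n; rewrite /= in_itv/= => /triangle_bounds/andP[h1 h2].
  rewrite lee_fin normrM mulr_ile1//; first by rewrite ger0_norm.
  by rewrite normrM mulr_ile1// ?cos_max//; have [] := pf n.
have hR : (fun n => \int[mu]_(w in `]0, T]) (triangle w * (f_ n w * cos (0 + z * w)))) @ \oo -->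
   \int[mu]_(w in `]0, T]) (triangle w * (f w * cos (0 + z * w))).
  apply: fine_cvg; rewrite /Rintegral fineK; first exact: hcvg.
  exact: integrable_fin_num.
by apply: (cvgr_to_ge hR); apply: nearW => n; have [] := pf n.
Qed.

Lemma posdefM_rhat (f : R -> R) (n : nat) : posdef f -> posdef (fun w => f w * rhat w n).
Proof.
move=> pf; apply: (@posdef_lim (fun J w => f w * cosprod (w * n%:R) J)) => [J|w].
  elim: J => [|J IHJ]; first by under eq_fun do rewrite cosprod0 mulr1.
  under eq_fun do rewrite cosprodS mulrA.
  have -> : (fun w => f w * cosprod (w * n%:R) J * cos (w * n%:R / 3 ^+ J.+1)) =
      (fun w => f w * cosprod (w * n%:R) J * cos (0 + (n%:R / 3 ^+ J.+1) * w)).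
    by apply/funext => w; congr (_ * cos _); rewrite add0r; ring.
  exact: posdefM_cos.
by apply: cvgMl_tmp; exact: cvg_rhat.
Qed.

Lemma posdefM_prod_rhat (f : R -> R) (s : seq nat) : posdef f ->
  posdef (fun w => f w * \prod_(n <- s) rhat w n).
Proof.
elim: s f => [|n s IHs] f pf.
  by under eq_fun do rewrite big_nil mulr1.
under eq_fun do rewrite big_cons mulrA.
exact/IHs/posdefM_rhat.
Qed.

Lemma posdef_prods (s t : seq nat) :
  posdef (fun w => (\prod_(n <- s) rhat w n) * \prod_(n <- t) rhat w n).
Proof.
apply: posdefM_prod_rhat.
have := posdefM_prod_rhat s posdef1.
by under eq_fun do rewrite mul1r.
Qed.

End positive_definite.

(** * Non-vanishing *)

Section nonvanishing.
Context {R : realType}.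
Implicit Types (w x : R) (n k : nat).
Local Notation mu := (@lebesgue_measure R).

(** The losses x ^ 2 / (2 9 ^ j), j >= 1, add up to x ^ 2 / 16. *)
Lemma cosprod_ge x J : 0 <= x <= 1 ->
  1 - (1 - 9^-1 ^+ J) / 16 <= cosprod x J.
Proof.
move=> /andP[x0 x1]; have x2 : x ^+ 2 <= 1 by rewrite expr_le1.
elim: J => [|J IHJ]; first by rewrite cosprod0 expr0 subrr mul0r subr0.
rewrite cosprodS; set q := 9^-1 ^+ J in IHJ.
have q0 : 0 <= q by rewrite /q exprn_ge0.
have q1 : q <= 1 by rewrite /q exprn_ile1// invf_le1// ler1n.
have p1 : cosprod x J <= 1 by exact: le_trans (ler_norm _) (norm_cosprod_le1 _ _).
have hc : 1 - q / 18 <= cos (x / 3 ^+ J.+1).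
  apply: le_trans (cos_ge_onem _); rewrite lerD2l lerN2 expr_div_n.
  have -> : (3 ^+ J.+1 : R) ^+ 2 = 9 * 9 ^+ J.
    by rewrite -exprM mulnC exprM (_ : 3 ^+ 2 = 9 :> R) ?exprS//; ring.
  have -> : x ^+ 2 / (9 * 9 ^+ J) / 2 = x ^+ 2 * (q / 18).
    rewrite /q exprVn; field; by rewrite expf_neq0.
  by rewrite ler_piMl// divr_ge0.
rewrite exprS -/q; set p := cosprod x J in IHJ p1 *.
set c := cos _ in hc *.
have : p * (1 - q / 18) <= p * c by rewrite ler_wpM2l//; lra.
nra.
Qed.

Lemma rhat_ge_half w n : 0 <= w -> w * n%:R <= 1 -> 2^-1 <= rhat w n.
Proof.
move=> w0 wn; have hl : cosprod (w * n%:R) @ \oo --> (rhat w n : R) by exact: cvg_rhat.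
apply: (cvgr_to_ge hl); apply: nearW => J.
have h : 0 <= w * n%:R <= 1 by rewrite wn mulr_ge0.
apply: le_trans (cosprod_ge J h).
have : 0 <= 9^-1 ^+ J :> R by rewrite exprn_ge0.
lra.
Qed.

Lemma prod_rhat_ge w (s : seq nat) : 0 <= w ->
  (forall n, n \in s -> w * n%:R <= 1) -> 2^-1 ^+ size s <= \prod_(n <- s) rhat w n.
Proof.
move=> w0; elim: s => [|n s IHs] hs; first by rewrite big_nil expr0.
rewrite big_cons /= exprS; apply: ler_pM; rewrite ?exprn_ge0 ?invr_ge0//.
  by rewrite rhat_ge_half// hs ?mem_head.
by apply: IHs => m ms; rewrite hs// in_cons ms orbT.
Qed.

(** Both tuples start with a triple of sum 13 and product 36, and continue with
    the same entries equal to 1. *)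
Definition witness (k' : nat) : k'.+3.-tuple nat * k'.+3.-tuple nat :=
  ([tuple of [:: 1, 6, 6 & nseq_tuple k' 1]]%N, [tuple of [:: 2, 2, 9 & nseq_tuple k' 1]]%N).

Lemma witness_offdiag k' : offdiag k'.+3 (witness k').
Proof.
split; first split.
- split=> /=.
  + by apply/allP => n; rewrite mem_nseq => /andP[_ /eqP ->].
  + by apply/allP => n; rewrite mem_nseq => /andP[_ /eqP ->].
  + by rewrite !big_cons !mulnA.
- by rewrite /equal_sums/= !big_cons !addnA.
- rewrite /same_mset/= => /eq_seq_msetP/perm_mem/(_ 6%N).
  by rewrite !inE mem_nseq andbF.
Qed.

Lemma integral_triangle (T : R) : 0 < T ->
  \int[mu]_(w in `]0, T]) triangle T w = T / 2.
Proof.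
move=> T0; rewrite Rintegral_itv_obnd_cbnd; last first.
  apply: (@integrable_bounded_itv _ _ T0 _ 1); first exact: measurable_triangle.
  by move=> w /(triangle_bounds T0)/andP[h1 h2]; rewrite ger0_norm.
pose A w : R := 1 + (- T^-1) * w.
have dF w : is_derive w (1 : R) ((- T / 2) \*: (A * A)) (triangle T w).
  have dA : is_derive w (1 : R) A (- T^-1) := is_derive_affine _ _ _.
  apply: is_derive_eq (is_deriveZ (- T / 2) (is_deriveM dA dA)) _.
  by rewrite /GRing.scale /= /triangle /A; field; rewrite gt_eqF.
have cf w : {for w, continuous (triangle T)}.
  by apply: cvgB; [exact: cvg_cst|apply: cvgMr_tmp; exact: cvg_id].
rewrite (Rintegral_FTC T0 (fun w _ => dF w) (fun w _ => cf w)).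
rewrite !fctE /= /GRing.scale/= /A; field; by rewrite gt_eqF.
Qed.

(** If the off-diagonal sum vanished for all small w, its integral over ]0, T]
    against the triangle function would be 0.  But the integral may be taken term
    by term, by [esum_coef_le], every term has a nonnegative integral because
    [coef] is a product of cosines in w, and the term of [witness] has a positive
    one. *)
Lemma exists_VO2k_neq0 k : (3 <= k)%N ->
  exists w, [/\ 0 < w, w < 1 & VO2k w k != 0].
Proof.
case: k => [//|[//|[//|k' _]]]; set k := k'.+3.
have k0 : (0 < k)%N by [].
apply: contrapT => hno.
(* the entries of the witness are at most 9, so w n <= 1 for them when w <= T *)
pose T : R := 9^-1; have T0 : 0 < T by rewrite invr_gt0.
have T1 : T < 1 by rewrite invf_lt1// ltr1n.
have pi2 := @pi_ge2 R.
have VO0 w : 0 < w <= T -> VO2k w k = 0.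
  move=> /andP[w0 wT]; apply/eqP/negPn/negP => h; apply: hno; exists w; split=> //.
  exact: le_lt_trans T1.
have [C C0 hC] := @esum_coef_le R k k0.
have cs w : 0 < w <= T -> abs_summable (D_index k) (@coef R w k).
  move=> /andP[w0 wT]; apply: abs_summable_coef => //.
  by rewrite (le_lt_trans wT)// (lt_trans T1)//; lra.
have odD nm : offdiag k nm -> D_index k nm by case=> -[].
pose f (nm : k.-tuple nat * k.-tuple nat) w := triangle T w * coef w nm.
have fle w nm : 0 < w <= T -> `|f nm w| <= `|coef w nm|.
  move=> /(triangle_bounds T0)/andP[h1 h2].
  by rewrite /f normrM ler_piMl// ger0_norm.
have mcoef nm : measurable_fun setT (fun w => coef w nm : R).
  apply: measurable_funM => //.
  by have [] := posdef_prods T0 nm.1 nm.2.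
have [||||_ hcvg] := @integral_rsum R _ _ _ mu (offdiag k) `]0, T]%classic f
  (fun w => C / Num.sqrt w).
- exact: measurable_itv.
- move=> nm _; apply: measurable_funTS; apply: measurable_funM.
    exact: measurable_triangle.
  exact: mcoef.
- exact: integrable_invsqrt.
- move=> w; rewrite /= in_itv/= => wT.
  have /andP[w0 w1] := wT.
  apply: le_trans (hC w w0 _); last by rewrite (le_lt_trans w1)// (lt_trans T1)//; lra.
  apply: (@le_trans _ _ (\esum_(nm in offdiag k) `|coef w nm|%:E)).
    by apply: le_esum => nm _; rewrite lee_fin fle.
  rewrite esum_mkcond [leRHS]esum_mkcond; apply: le_esum => nm _.
  case: ifPn => [|_]; last by case: ifP.
  by rewrite inE => /odD h; rewrite mem_set.
have rs0 : \int[mu]_(w in `]0, T]) rsum (offdiag k) (f^~ w) = 0.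
  transitivity (\int[mu]_(w in `]0, T]) (0 : R)); last by rewrite Rintegral_cst// mul0r.
  apply: eq_Rintegral => w; rewrite inE /= in_itv/= => wT.
  have cw := cs w wT; have [_ hVO] := rsum_offdiag cw.
  have co : abs_summable (offdiag k) (@coef R w k).
    by apply: abs_summable_sub cw => nm; exact: odD.
  have fs : abs_summable (offdiag k) (f^~ w).
    by apply: abs_summable_le co => nm _; exact: fle.
  apply: (cvg_unique _ (cvg_enumf fs)) => //.
  have h : (fun n => triangle T w * series (enumf (offdiag k) (@coef R w k)) n) @ \oo -->
      triangle T w * rsum (offdiag k) (@coef R w k).
    by apply: cvgMl_tmp; exact: cvg_enumf.
  rewrite hVO VO0// mulr0 in h.
  apply: cvg_trans h; apply: near_eq_cvg; apply: nearW => n.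
  by rewrite -series_enumfZ.
rewrite rs0 in hcvg.
pose I nm := \int[mu]_(w in `]0, T]) f nm w.
have IE nm : I nm = (\prod_(n <- nm.1) n)%N%:R^-1 *
   \int[mu]_(w in `]0, T]) (triangle T w *
      ((\prod_(n <- nm.1) rhat w n) * (\prod_(n <- nm.2) rhat w n) * cos (0 + 0 * w))).
  have [mp p1 _] := posdef_prods T0 nm.1 nm.2.
  rewrite -RintegralZl//; last exact: (integrable_posdef T0 0 mp p1).
  apply: eq_Rintegral => w _; rewrite mul0r addr0 cos0 mulr1 /f /coef; ring.
have I0 nm : 0 <= I nm.
  have [_ _ pp] := posdef_prods T0 nm.1 nm.2.
  by rewrite IE mulr_ge0 ?invr_ge0//; exact: pp.
pose nm0 := witness k'.
pose c0 : R := (2^-1 ^+ k) * (2^-1 ^+ k) / (\prod_(n <- nm0.1) n)%N%:R.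
have c0_gt0 : 0 < c0.
  apply: divr_gt0; first by rewrite mulr_gt0// exprn_gt0// invr_gt0.
  rewrite ltr0n big_seq prodn_cond_gt0//.
  by move=> n; have [[[/allP h _ _] _] _] := witness_offdiag k' => /h.
have Iw : 0 < I nm0.
  apply: (@lt_le_trans _ _ (\int[mu]_(w in `]0, T]) (triangle T w * c0))).
    rewrite RintegralZr//=; last first.
      apply: (@integrable_bounded_itv _ _ T0 _ 1 (measurable_triangle T)) => w.
      by move=> /(triangle_bounds T0)/andP[h1 h2]; rewrite ger0_norm.
    rewrite mulr_gt0//.
    by rewrite integral_triangle// divr_gt0.
  apply: le_Rintegral => //.
  - apply: (@integrable_bounded_itv _ _ T0 (fun w => triangle T w * c0) c0).
      by apply: measurable_funM => //; exact: measurable_triangle.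
    move=> w /(triangle_bounds T0)/andP[h1 h2].
    by rewrite normrM (gtr0_norm c0_gt0) ler_piMl ?(ltW c0_gt0)// ger0_norm.
  - have [mp p1 _] := posdef_prods T0 nm0.1 nm0.2.
    apply: (@integrable_bounded_itv _ _ T0 (f nm0) (\prod_(n <- nm0.1) n)%N%:R^-1).
      by apply: measurable_funM; [exact: measurable_triangle|exact: mcoef].
    move=> w wT; rewrite (le_trans (fle w nm0 wT))// /coef normrM.
    by rewrite [X in _ * X]ger0_norm ?invr_ge0// ler_piMl ?invr_ge0//; exact: p1.
  move=> w; rewrite /= in_itv/= => wT; have /andP[w0 w1] := wT.
  have /andP[t0 _] := triangle_bounds T0 wT.
  rewrite /f ler_wpM2l// /c0 /coef ler_wpM2r ?invr_ge0//.
  have w9 (n : nat) : (n <= 9)%N -> w * n%:R <= 1.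
    move=> n9; apply: (@le_trans _ _ (T * 9)); last by rewrite mulVf.
    by apply: ler_pM => //; [exact: ltW|rewrite ler_nat].
  have hp (t : k.-tuple nat) : (forall n, n \in val t -> (n <= 9)%N) ->
      2^-1 ^+ k <= \prod_(n <- t) rhat w n.
    move=> t9; have {1}<- := size_tuple t.
    by apply: prod_rhat_ge; [exact: ltW|move=> n /t9/w9].
  by apply: ler_pM; rewrite ?exprn_ge0 ?invr_ge0//; apply: hp => n;
    rewrite !inE mem_nseq => /or4P[|||/andP[_]] /eqP ->.
have hge n : (choice.pickle nm0 < n)%N -> I nm0 <= series (enumf (offdiag k) I) n.
  move=> hn; rewrite seriesEnat/= (bigD1_seq (choice.pickle nm0)) ?mem_index_iota ?iota_uniq//=.
  rewrite {1}/enumf pickleK_inv mem_set; last exact: witness_offdiag.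
  rewrite lerDl sumr_ge0// => j _; rewrite /enumf; case: pickle_inv => // nm.
  by case: ifP.
have : I nm0 <= 0.
  apply: (cvgr_to_ge hcvg); near=> n; apply: hge; near: n; exact: nbhs_infty_gt.
by rewrite leNgt Iw.
Unshelve. all: by end_near.
Qed.

End nonvanishing.

(** * Triples of positive integers *)

Section triples.
Local Open Scope nat_scope.

Lemma Mset3P P S (M : {mset nat}) : Mset 3 P S M ->
  exists a b c : nat, [/\ M = seq_mset [:: a; b; c], 0 < a, a <= b <= c,
    a * b * c = P & a + b + c = S].
Proof.
move=> [sM M0 MP MS].
have sp : perm_eq (sort leq M) M by rewrite perm_sort.
have ss := sort_sorted leq_total M.
have MsM : M = seq_mset (sort leq M).
  by rewrite -[LHS]seq_mset_id; apply/esym/eq_seq_msetP.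
have := perm_size sp; rewrite sM.
have sP : \prod_(v <- sort leq M) v = \prod_(v <- M) v by exact: perm_big sp.
have sS : \sum_(v <- sort leq M) v = \sum_(v <- M) v by exact: perm_big sp.
rewrite MP in sP; rewrite MS in sS.
move: MsM ss sP sS; case: (sort leq M) sp => [|a [|b [|c [|]]]]//= sp ME /and3P[ab bc _].
rewrite !big_cons !big_nil muln1 addn0 => sP sS _.
exists a, b, c; split => //.
- by apply: M0; rewrite -(perm_mem sp) mem_head.
- by rewrite ab.
- by rewrite -mulnA.
- by rewrite -addnA.
Qed.

(** The last entry of the second triple is recovered from the sum, so that the
    search has five variables only. *)
Definition triple_check (m n : nat) (Q : nat -> nat -> nat -> bool) : bool :=
  all (fun a => all (fun b => all (fun c => all (fun d => all (fun e =>
    let f := a + b + c - d - e in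
    [&& 0 < a, a <= b <= c, 0 < d, d <= e <= f, Q a b c, a * b * c == d * e * f &
      d + e <= a + b + c] ==>
    (a == d) && (b == e)) (iota 0 m)) (iota 0 m)) (iota 0 n)) (iota 0 m)) (iota 0 m).

Lemma triple_check_prod : triple_check 6 36 (fun a b c => a * b * c < 36).
Proof. by vm_compute. Qed.

Lemma triple_check_sum : triple_check 7 13 (fun a b c => a + b + c < 13).
Proof. by vm_compute. Qed.

Lemma triple_checkP m n Q a b c d e f : triple_check m n Q ->
    0 < a -> a <= b <= c -> 0 < d -> d <= e <= f -> Q a b c ->
    a * b * c = d * e * f -> a + b + c = d + e + f ->
    b < m -> c < n -> e < m ->
  [:: a; b; c] = [:: d; e; f].
Proof.
move=> chk a0 abc d0 def q eP eS bm cn em.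
have am : a \in iota 0 m by rewrite mem_iota; lia.
have bm' : b \in iota 0 m by rewrite mem_iota; lia.
have cm : c \in iota 0 n by rewrite mem_iota; lia.
have dm : d \in iota 0 m by rewrite mem_iota; lia.
have em' : e \in iota 0 m by rewrite mem_iota; lia.
have /allP/(_ a am)/allP/(_ b bm')/allP/(_ c cm)/allP/(_ d dm)/allP/(_ e em')/= := chk.
have -> : a + b + c - d - e = f by lia.
rewrite a0 abc d0 def q eP eqxx eS leq_addr /= => /andP[/eqP ad /eqP be].
by rewrite ad be; congr [:: _; _; _]; lia.
Qed.

Lemma middle_lt6 a b c : 0 < a -> a <= b <= c -> a * b * c < 36 -> b < 6.
Proof.
move=> a0 /andP[ab bc] abc; rewrite -(@ltn_sqr b 6) -mulnn.
by apply: leq_ltn_trans abc; apply: leq_mul => //; exact: leq_pmull.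
Qed.

Lemma VO_index3_ge P S : VO_index 3 (P, S) -> 36 <= P /\ 13 <= S.
Proof.
rewrite /VO_index /= => hX.
have [M [M' [hM hM' MM']]] : exists M M', [/\ Mset 3 P S M, Mset 3 P S M' & M <> M'].
  have XE N : N \in Mfset 3 P S -> Mset 3 P S N.
    by rewrite /Mfset in_fset_set ?inE//; exact: finite_Mset.
  have /fset0Pn[M MX] : Mfset 3 P S != fset0.
    by rewrite -cardfs_gt0; exact: leq_trans hX.
  have /fset0Pn[M'] : (Mfset 3 P S `\ M)%fset != fset0.
    by rewrite -cardfs_gt0; move: hX; rewrite (cardfsD1 M (Mfset 3 P S)) MX.
  rewrite in_fsetD1 => /andP[M'M M'X].
  by exists M, M'; split; [exact: XE|exact: XE|move=> e; rewrite e eqxx in M'M].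
have [a [b [c [ME a0 abc aP aS]]]] := Mset3P hM.
have [d [e [f [ME' d0 def dP dS]]]] := Mset3P hM'.
have eP : a * b * c = d * e * f by rewrite aP dP.
have eS : a + b + c = d + e + f by rewrite aS dS.
split; rewrite leqNgt; apply/negP => h; apply: MM'; rewrite ME ME'; congr seq_mset.
- apply: (triple_checkP triple_check_prod) => //; first by rewrite aP.
  + exact: (middle_lt6 a0 abc (leq_ltn_trans (eq_leq aP) h)).
  + rewrite -aP in h; apply: leq_ltn_trans h; apply: leq_pmull.
    by case/andP: abc => ab _; rewrite muln_gt0 a0 (leq_trans a0).
  + exact: (middle_lt6 d0 def (leq_ltn_trans (eq_leq dP) h)).
- by apply: (triple_checkP triple_check_sum a0 abc d0 def _ eP eS) => /=; lia.
Qed.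

Lemma mset166E : [mset 1; 6; 6]%mset = seq_mset [:: 1; 6; 6] :> {mset nat}.
Proof. by apply/msetP => v; rewrite mset_seqE !msetE2 !msetnE /= ![_ == v]eq_sym addn0 addnA; do 2!case: (v == _). Qed.

Lemma mset229E : [mset 2; 2; 9]%mset = seq_mset [:: 2; 2; 9] :> {mset nat}.
Proof. by apply/msetP => v; rewrite mset_seqE !msetE2 !msetnE /= ![_ == v]eq_sym addn0 addnA; do 2!case: (v == _). Qed.

Lemma mset166_neq_mset229 : [mset 1; 6; 6]%mset <> [mset 2; 2; 9]%mset :> {mset nat}.
Proof. by rewrite mset166E mset229E => /eq_seq_msetP. Qed.

Lemma Mset3_36_13 (M : {mset nat}) : Mset 3 36 13 M <->
  M = seq_mset [:: 1; 6; 6] \/ M = seq_mset [:: 2; 2; 9].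
Proof.
split.
  move=> /Mset3P[a [b [c [-> a0 /andP[ab bc] aP aS]]]].
  have chk : all (fun a => all (fun b => let c := 13 - a - b in
      [&& 0 < a, a <= b, b <= c & a * b * c == 36] ==>
      ([:: a; b; c] == [:: 1; 6; 6]) || ([:: a; b; c] == [:: 2; 2; 9])) (iota 0 13)) (iota 0 13).
    by vm_compute.
  have am : a \in iota 0 13 by rewrite mem_iota; lia.
  have bm : b \in iota 0 13 by rewrite mem_iota; lia.
  have /allP/(_ a am)/allP/(_ b bm)/= := chk.
  have -> : 13 - a - b = c by lia.
  by rewrite a0 ab bc aP eqxx /= => /orP[]/eqP ->; [left|right].
have h (t : 3.-tuple nat) : all (leq 1) t -> \prod_(v <- t) v = 36 ->
    \sum_(v <- t) v = 13 -> Mset 3 36 13 (seq_mset t).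
  by move=> t0 <- <-; exact: seq_mset_Mset.
case=> ->.
- by apply: (h [tuple 1; 6; 6]) => //; rewrite !big_cons big_nil.
- by apply: (h [tuple 2; 2; 9]) => //; rewrite !big_cons big_nil.
Qed.

Lemma Mfset3_36_13 : Mfset 3 36 13 =
  [fset [mset 1; 6; 6]%mset; [mset 2; 2; 9]%mset]%fset.
Proof.
apply/fsetP => M; rewrite mset166E mset229E in_fset2 in_fset_set; last exact: finite_Mset.
apply/idP/idP; first by rewrite inE => /Mset3_36_13[] ->; rewrite eqxx ?orbT.
by move=> /orP[]/eqP hM; rewrite mem_set//; apply/Mset3_36_13; [left|right].
Qed.

End triples.

Theorem proposition9p22 (R : realType) :
  (forall (k : nat) (theta0 theta1 : R),
     (3 <= k)%N -> 0 < theta0 -> theta0 < theta1 -> theta1 < 2 * pi ->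
     let w := theta1 - theta0 in
     [/\ forall phi : R, csummable (D_index k) (D_term w k phi),
         cintegrable lebesgue_measure `[0, 2 * pi] (D2k w k),
         summable (VO_index k) (fun PS => (VO_term w k PS)%:E) &
         forall phi : R,
           ((2 * pi)^-1)%:C * cintegral lebesgue_measure `[0, 2 * pi] (D2k w k)
           = D2k_Wick w k phi + (VO2k w k)%:C])
  /\
  (forall k : nat, (3 <= k)%N ->
     exists theta0 theta1 : R,
       [/\ 0 < theta0, theta0 < theta1, theta1 < 2 * pi &
           VO2k (theta1 - theta0) k != 0])
  /\
  [/\ [mset 1%N; 6%N; 6%N]%mset <>
        [mset 2%N; 2%N; 9%N]%mset :> {mset nat},
      Mfset 3 36 13 =
        [fset [mset 1%N; 6%N; 6%N]%mset; [mset 2%N; 2%N; 9%N]%mset]%fset &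
      forall P S : nat, VO_index 3 (P, S) -> (36 <= P)%N /\ (13 <= S)%N].
Proof.
split; [|split; [|split]].
- move=> k theta0 theta1 k3 h0 h01 h1 w.
  have k0 : (0 < k)%N by exact: leq_trans k3.
  have w0 : 0 < w by rewrite subr_gt0.
  have w2 : w < 2 * pi by rewrite ltrBlDr (lt_trans h1)// ltrDl.
  have [VOs VOE] := rsum_offdiag (abs_summable_coef k0 w0 w2).
  split => // [phi||phi].
  + exact: csummable_D_term.
  + exact: cintegrable_D2k.
  + by rewrite (average_D2k k0 w0 w2 phi) -VOE.
- move=> k k3; have [w [w0 w1 VO0]] := @exists_VO2k_neq0 R k k3.
  exists 1, (1 + w); rewrite addrAC subrr add0r; split => //.
    by rewrite ltrDl.
  by have := @pi_ge2 R; lra.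
- exact: mset166_neq_mset229.
- exact: Mfset3_36_13.
- exact: VO_index3_ge.
Qed.
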